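(* Let $d,n\ge1$, let $R$ be a commutative ring and let $\theta:\mathbb C[u^{\pm1},v]\to R$ be a specialization (ring homomorphism). Then the algebra $R_\theta Y_{d,n}$ is Morita equivalent to $\bigoplus_{\mu\in\operatorname{Comp}_d(n)}R_\theta\mathcal H^\mu$.
   Context: Let $u,v$ be indeterminates and $A=\mathbb C[u^{\pm1},v]$. For an $A$-algebra $\mathcal B$, $R_\theta\mathcal B:=R\otimes_A\mathcal B$, the tensor product being formed via $\theta$. $\mathcal H_n$ is the associative unital $A$-algebra with generators $T_1,\dots,T_{n-1}$ and relations $T_iT_j=T_jT_i$ ($|i-j|>1$), $T_iT_{i+1}T_i=T_{i+1}T_iT_{i+1}$, $T_i^2=u^2+vT_i$; $\mathcal H_0=\mathcal H_1=A$. $\operatorname{Comp}_d(n)$ is the set of $d$-tuples $\mu=(\mu_1,\dots,\mu_d)$ of non-negative integers with sum $n$. $\mathcal H^\mu\subset\mathcal H_n$ is the subalgebra generated by the $T_i$ with $i\in\{1,\dots,n-1\}\setminus\{\mu_1,\mu_1+\mu_2,\dots,\mu_1+\dots+\mu_{d-1}\}$; it is isomorphic to $\mathcal H_{\mu_1}\otimes_A\dots\otimes_A\mathcal H_{\mu_d}$. $Y_{d,n}$ is the associative unital $A$-algebra with generators $g_1,\dots,g_{n-1},t_1,\dots,t_n$ and relations $g_ig_j=g_jg_i$ ($|i-j|>1$), $g_ig_{i+1}g_i=g_{i+1}g_ig_{i+1}$, $t_it_j=t_jt_i$, $g_it_j=t_{s_i(j)}g_i$ (with $s_i=(i,i+1)$),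 $t_j^d=1$, $g_i^2=u^2+v\,e_ig_i$, where $e_i=\frac1d\sum_{s=0}^{d-1}t_i^st_{i+1}^{-s}$. *)

(* Defs.v *)
From HB Require Import structures.
From mathcomp Require Import all_boot all_order perm all_algebra.
From mathcomp Require Import boolp reals.
From mathcomp.real_closed Require Import complex.

Set Implicit Arguments.
Unset Strict Implicit.
Unset Printing Implicit Defensive.

Import GRing.Theory.
Local Open Scope ring_scope.
Local Open Scope quotient_scope.

(** * Algebras over a commutative ring *)

(* MathComp's [algType] only covers nonzero rings, which would exclude the
   algebras arising here when the base ring R is zero.  An R-algebra is therefore
   a unital associative ring together with a ring morphism from R to its
   centre. *)
Record algebra (R : comPzRingType) := Algebra {
  alg_carrier :> pzRingType;
  alg_scalar : {rmorphism R -> alg_carrier};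
  alg_scalarC : forall r x, alg_scalar r * x = x * alg_scalar r
}.
Arguments alg_scalar {R} a.

(** * The ring C[u^{+-1}, v] *)

Section LaurentRing.
Variable K : realType.

(* Inside the fraction field of C[v][u], where u is the outer variable, the ring
   C[u^{+-1}, v] consists of the fractions p / u^k. *)
Notation Cuv_frac := {fraction {poly {poly K[i]}}}.

Definition is_Cuv (x : Cuv_frac) : bool :=
  `[< exists (p : {poly {poly K[i]}}) (k : nat), x = tofrac p / tofrac 'X ^+ k >].

Lemma tofracX_neq0 k : (tofrac 'X ^+ k : Cuv_frac) != 0.
Proof. by rewrite expf_neq0 // tofrac_eq0 polyX_eq0. Qed.

Lemma is_Cuv_tofrac (p : {poly {poly K[i]}}) : is_Cuv (tofrac p).
Proof. by apply/asboolP; exists p, 0%N; rewrite expr0 divr1. Qed.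

Lemma is_Cuv_subring : subring_closed is_Cuv.
Proof.
split=> [|x y /asboolP[p [k ->]] /asboolP[q [l ->]]|
         x y /asboolP[p [k ->]] /asboolP[q [l ->]]].
- by rewrite -tofrac1; apply: is_Cuv_tofrac.
- apply/asboolP; exists (p * 'X ^+ l - q * 'X ^+ k), (k + l)%N.
  by rewrite -mulNr addf_div ?tofracX_neq0// tofracB !tofracM !tofracXn exprD mulNr.
- by apply/asboolP; exists (p * q), (k + l)%N; rewrite mulf_div tofracM exprD.
Qed.

Definition Cuv := {x : Cuv_frac | is_Cuv x}.
HB.instance Definition _ := SubChoice.on Cuv.
HB.instance Definition _ :=
  GRing.SubChoice_isSubComNzRing.Build Cuv_frac is_Cuv Cuv is_Cuv_subring.

Definition Cuv_const (c : K[i]) : Cuv := Sub (tofrac c%:P%:P) (is_Cuv_tofrac _).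
Definition Cuv_u : Cuv := Sub (tofrac 'X) (is_Cuv_tofrac _).
Definition Cuv_v : Cuv := Sub (tofrac 'X%:P) (is_Cuv_tofrac _).

End LaurentRing.

(** * Presented algebras *)

(* Formal expressions in generators X with coefficients in R.  The algebra with
   generators X and relations rel is their quotient by the smallest congruence
   that contains rel and the algebra laws; the opposite of t is (-1) t. *)
Inductive term (R X : Type) : Type :=
  | Gen of X
  | Cst of R
  | Add of term R X & term R X
  | Mul of term R X & term R X.
Arguments Gen {R X} _.
Arguments Cst {R X} _.

Declare Scope pterm_scope.
Delimit Scope pterm_scope with pterm.
Bind Scope pterm_scope with term.
Notation "s + t" := (Add s t) : pterm_scope.
Notation "s * t" := (Mul s t) : pterm_scope.

Definition Exp (R : pzRingType) X (t : term R X) (k : nat) : term R X :=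
  iter k (Mul t) (Cst 1).
Notation "t ^+ k" := (Exp t k) : pterm_scope.

HB.instance Definition _ R X := gen_eqMixin (term R X).
HB.instance Definition _ R X := gen_choiceMixin (term R X).

Section Presented.
Variables (R : comPzRingType) (X : Type) (rel : term R X -> term R X -> Prop).
Local Notation term := (term R X).

Inductive congr : term -> term -> Prop :=
  | congr_rel s t : rel s t -> congr s t
  | congr_refl t : congr t t
  | congr_sym s t : congr s t -> congr t s
  | congr_trans s t w : congr s t -> congr t w -> congr s w
  | congr_add s s' t t' : congr s s' -> congr t t' -> congr (s + t) (s' + t')
  | congr_mul s s' t t' : congr s s' -> congr t t' -> congr (s * t) (s' * t')
  | congr_addA s t w : congr (s + (t + w)) (s + t + w)
  | congr_addC s t : congr (s + t) (t + s)
  | congr_add0 t : congr (Cst 0 + t) t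
  | congr_addN t : congr (Cst (-1) * t + t) (Cst 0)
  | congr_mulA s t w : congr (s * (t * w)) (s * t * w)
  | congr_mul1 t : congr (Cst 1 * t) t
  | congr_mulDl s t w : congr ((s + t) * w) (s * w + t * w)
  | congr_mulDr s t w : congr (s * (t + w)) (s * t + s * w)
  | congr_cstD a b : congr (Cst (a + b)%R) (Cst a + Cst b)
  | congr_cstM a b : congr (Cst (a * b)%R) (Cst a * Cst b)
  | congr_cstC a t : congr (Cst a * t) (t * Cst a).

Definition congrb (s t : term) : bool := `[< congr s t >].

Lemma congrb_refl : reflexive congrb.
Proof. by move=> s; apply/asboolP; apply: congr_refl. Qed.
Lemma congrb_sym : symmetric congrb.
Proof. by move=> s t; apply/asboolP/asboolP => /congr_sym. Qed.
Lemma congrb_trans : transitive congrb.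
Proof.
by move=> t s w /asboolP st /asboolP tw; apply/asboolP; apply: congr_trans tw.
Qed.
Canonical congr_equiv := EquivRel congrb congrb_refl congrb_sym congrb_trans.

Definition presented := {eq_quot congr_equiv}.
HB.instance Definition _ := Choice.on presented.
Local Notation cls := (\pi_presented).

Lemma pres_eqP s t : cls s = cls t <-> congr s t.
Proof.
by split=> [/eqmodP/asboolP|st]; [|apply/eqmodP/asboolP].
Qed.

Lemma pres_repr t : congr (repr (cls t)) t.
Proof. by apply/pres_eqP; rewrite reprK. Qed.

Definition pres_add (x y : presented) := cls (repr x + repr y)%pterm.
Definition pres_mul (x y : presented) := cls (repr x * repr y)%pterm.
Definition pres_opp (x : presented) := cls (Cst (-1) * repr x)%pterm.

Lemma pres_addE s t : pres_add (cls s) (cls t) = cls (s + t)%pterm.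
Proof. by apply/pres_eqP/congr_add; apply: pres_repr. Qed.
Lemma pres_mulE s t : pres_mul (cls s) (cls t) = cls (s * t)%pterm.
Proof. by apply/pres_eqP/congr_mul; apply: pres_repr. Qed.
Lemma pres_oppE t : pres_opp (cls t) = cls (Cst (-1) * t)%pterm.
Proof. by apply/pres_eqP/congr_mul; [apply: congr_refl|apply: pres_repr]. Qed.

Lemma pres_addA : associative pres_add.
Proof.
elim/quotW=> s; elim/quotW=> t; elim/quotW=> w.
rewrite (pres_addE t w) (pres_addE s t) !pres_addE.
by apply/pres_eqP; apply: congr_addA.
Qed.
Lemma pres_addC : commutative pres_add.
Proof.
elim/quotW=> s; elim/quotW=> t.
by rewrite !pres_addE; apply/pres_eqP; apply: congr_addC.
Qed.
Lemma pres_add0 : left_id (cls (Cst 0)) pres_add.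
Proof. by elim/quotW=> t; rewrite pres_addE; apply/pres_eqP; apply: congr_add0. Qed.
Lemma pres_addN : left_inverse (cls (Cst 0)) pres_opp pres_add.
Proof.
by elim/quotW=> t; rewrite pres_oppE pres_addE; apply/pres_eqP; apply: congr_addN.
Qed.
Lemma pres_mulA : associative pres_mul.
Proof.
elim/quotW=> s; elim/quotW=> t; elim/quotW=> w.
rewrite (pres_mulE t w) (pres_mulE s t) !pres_mulE.
by apply/pres_eqP; apply: congr_mulA.
Qed.
Lemma pres_mul1l : left_id (cls (Cst 1)) pres_mul.
Proof. by elim/quotW=> t; rewrite pres_mulE; apply/pres_eqP; apply: congr_mul1. Qed.
Lemma pres_cstC a x : pres_mul (cls (Cst a)) x = pres_mul x (cls (Cst a)).
Proof.
by elim/quotW: x => t; rewrite !pres_mulE; apply/pres_eqP; apply: congr_cstC.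
Qed.
Lemma pres_mul1r : right_id (cls (Cst 1)) pres_mul.
Proof. by move=> x; rewrite -pres_cstC pres_mul1l. Qed.
Lemma pres_mulDl : left_distributive pres_mul pres_add.
Proof.
elim/quotW=> s; elim/quotW=> t; elim/quotW=> w.
rewrite (pres_addE s t) (pres_mulE s w) (pres_mulE t w) pres_mulE pres_addE.
by apply/pres_eqP; apply: congr_mulDl.
Qed.
Lemma pres_mulDr : right_distributive pres_mul pres_add.
Proof.
elim/quotW=> s; elim/quotW=> t; elim/quotW=> w.
rewrite (pres_addE t w) (pres_mulE s t) (pres_mulE s w) pres_mulE pres_addE.
by apply/pres_eqP; apply: congr_mulDr.
Qed.
HB.instance Definition _ := GRing.isPzRing.Build presented
  pres_addA pres_addC pres_add0 pres_addN
  pres_mulA pres_mul1l pres_mul1r pres_mulDl pres_mulDr.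

Definition pres_cst (a : R) : presented := cls (Cst a).

Lemma pres_cst_zmod : zmod_morphism pres_cst.
Proof.
have cstD a b : pres_cst (a + b) = pres_cst a + pres_cst b.
  by rewrite [RHS]pres_addE; apply/pres_eqP; apply: congr_cstD.
by move=> a b; apply/(addIr (pres_cst b)); rewrite -cstD !subrK.
Qed.
Lemma pres_cst_monoid : monoid_morphism pres_cst.
Proof.
by split=> // a b; rewrite [RHS]pres_mulE; apply/pres_eqP; apply: congr_cstM.
Qed.
HB.instance Definition _ :=
  GRing.isZmodMorphism.Build R presented pres_cst pres_cst_zmod.
HB.instance Definition _ :=
  GRing.isMonoidMorphism.Build R presented pres_cst pres_cst_monoid.

Definition presented_algebra : algebra R :=
  Algebra (alg_scalar := pres_cst) pres_cstC.

Definition pres_gen (x : X) : presented_algebra := cls (Gen x).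

End Presented.

(** * Generated subalgebras *)

Section Subalgebra.
Variables (R : comPzRingType) (B : algebra R) (S : B -> Prop).

Inductive in_subalg : B -> Prop :=
  | in_subalg_gen x : S x -> in_subalg x
  | in_subalg_scalar r : in_subalg (alg_scalar B r)
  | in_subalg_add x y : in_subalg x -> in_subalg y -> in_subalg (x + y)
  | in_subalg_mul x y : in_subalg x -> in_subalg y -> in_subalg (x * y).

Definition in_subalgb (x : B) : bool := `[< in_subalg x >].

Lemma in_subalg_subring : subring_closed in_subalgb.
Proof.
split=> [|x y /asboolP Sx /asboolP Sy|x y /asboolP Sx /asboolP Sy];
  apply/asboolP.
- by rewrite -(rmorph1 (alg_scalar B)); apply: in_subalg_scalar.
- apply: in_subalg_add => //; rewrite -mulN1r -(rmorphN1 (alg_scalar B)).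
  by apply: in_subalg_mul => //; apply: in_subalg_scalar.
- exact: in_subalg_mul.
Qed.

Definition subalg := {x : B | in_subalgb x}.
HB.instance Definition _ := SubChoice.on subalg.
HB.instance Definition _ :=
  GRing.SubChoice_isSubPzRing.Build B in_subalgb subalg in_subalg_subring.

Lemma subalg_scalar_subproof r : in_subalgb (alg_scalar B r).
Proof. by apply/asboolP; apply: in_subalg_scalar. Qed.
Definition subalg_scalar (r : R) : subalg := Sub _ (subalg_scalar_subproof r).

Lemma subalg_scalar_zmod : zmod_morphism subalg_scalar.
Proof. by move=> a b; apply: val_inj; rewrite /= rmorphB. Qed.
Lemma subalg_scalar_monoid : monoid_morphism subalg_scalar.
Proof.
by split=> [|a b]; apply: val_inj; rewrite /= ?rmorph1 ?rmorphM.
Qed.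
HB.instance Definition _ :=
  GRing.isZmodMorphism.Build R subalg subalg_scalar subalg_scalar_zmod.
HB.instance Definition _ :=
  GRing.isMonoidMorphism.Build R subalg subalg_scalar subalg_scalar_monoid.

Lemma subalg_scalarC r (x : subalg) : subalg_scalar r * x = x * subalg_scalar r.
Proof. by apply: val_inj; rewrite /= alg_scalarC. Qed.

Definition generated_subalgebra : algebra R :=
  Algebra (alg_scalar := subalg_scalar) subalg_scalarC.

End Subalgebra.

(** * Finite direct sums *)

Section DirectSum.
Variables (R : comPzRingType) (I : finType) (B : I -> algebra R).

(* As I is finite, the underlying module of the direct sum is the product. *)
Definition dsum := forall i, B i.
HB.instance Definition _ := gen_eqMixin dsum.
HB.instance Definition _ := gen_choiceMixin dsum.

Definition dsum0 : dsum := fun=> 0.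
Definition dsum1 : dsum := fun=> 1.
Definition dsum_opp (x : dsum) : dsum := fun i => - x i.
Definition dsum_add (x y : dsum) : dsum := fun i => x i + y i.
Definition dsum_mul (x y : dsum) : dsum := fun i => x i * y i.

Lemma dsum_addA : associative dsum_add.
Proof. by move=> x y z; apply: functional_extensionality_dep => i; apply: addrA. Qed.
Lemma dsum_addC : commutative dsum_add.
Proof. by move=> x y; apply: functional_extensionality_dep => i; apply: addrC. Qed.
Lemma dsum_add0 : left_id dsum0 dsum_add.
Proof. by move=> x; apply: functional_extensionality_dep => i; apply: add0r. Qed.
Lemma dsum_addN : left_inverse dsum0 dsum_opp dsum_add.
Proof. by move=> x; apply: functional_extensionality_dep => i; apply: addNr. Qed.
Lemma dsum_mulA : associative dsum_mul.
Proof. by move=> x y z; apply: functional_extensionality_dep => i; apply: mulrA. Qed.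
Lemma dsum_mul1l : left_id dsum1 dsum_mul.
Proof. by move=> x; apply: functional_extensionality_dep => i; apply: mul1r. Qed.
Lemma dsum_mul1r : right_id dsum1 dsum_mul.
Proof. by move=> x; apply: functional_extensionality_dep => i; apply: mulr1. Qed.
Lemma dsum_mulDl : left_distributive dsum_mul dsum_add.
Proof. by move=> x y z; apply: functional_extensionality_dep => i; apply: mulrDl. Qed.
Lemma dsum_mulDr : right_distributive dsum_mul dsum_add.
Proof. by move=> x y z; apply: functional_extensionality_dep => i; apply: mulrDr. Qed.
HB.instance Definition _ := GRing.isPzRing.Build dsum
  dsum_addA dsum_addC dsum_add0 dsum_addN
  dsum_mulA dsum_mul1l dsum_mul1r dsum_mulDl dsum_mulDr.

Definition dsum_scalar (r : R) : dsum := fun i => alg_scalar (B i) r.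
Lemma dsum_scalar_zmod : zmod_morphism dsum_scalar.
Proof.
by move=> a b; apply: functional_extensionality_dep => i; apply: rmorphB.
Qed.
Lemma dsum_scalar_monoid : monoid_morphism dsum_scalar.
Proof.
split=> [|a b]; apply: functional_extensionality_dep => i; first exact: rmorph1.
exact: rmorphM.
Qed.
HB.instance Definition _ :=
  GRing.isZmodMorphism.Build R dsum dsum_scalar dsum_scalar_zmod.
HB.instance Definition _ :=
  GRing.isMonoidMorphism.Build R dsum dsum_scalar dsum_scalar_monoid.

Lemma dsum_scalarC r (x : dsum) : dsum_scalar r * x = x * dsum_scalar r.
Proof. by apply: functional_extensionality_dep => i; apply: alg_scalarC. Qed.

Definition direct_sum : algebra R :=
  Algebra (alg_scalar := dsum_scalar) dsum_scalarC.

End DirectSum.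

(** * Extension of scalars *)

Section BaseChange.
Variables (A R : comPzRingType) (theta : {rmorphism A -> R}) (B : algebra A).

(* Elements of the tensor product over A of R and B are formal sums of pairs (r, b),
   up to biadditivity and A-balancedness.  The opposite of (r, b) is (-r, b). *)
Local Notation fsum := (seq (R * B)).

Inductive tens : fsum -> fsum -> Prop :=
  | tens_refl s : tens s s
  | tens_sym s t : tens s t -> tens t s
  | tens_trans s t w : tens s t -> tens t w -> tens s w
  | tens_cat s s' t t' : tens s s' -> tens t t' -> tens (s ++ t) (s' ++ t')
  | tens_catC s t : tens (s ++ t) (t ++ s)
  | tens_0l b : tens [:: (0, b)] [::]
  | tens_0r r : tens [:: (r, 0)] [::]
  | tens_addl r r' b : tens [:: (r + r', b)] [:: (r, b); (r', b)]
  | tens_addr r b b' : tens [:: (r, b + b')] [:: (r, b); (r, b')]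
  | tens_bal r a b : tens [:: (r * theta a, b)] [:: (r, alg_scalar B a * b)].

Definition tensb (s t : fsum) : bool := `[< tens s t >].

Lemma tensb_refl : reflexive tensb.
Proof. by move=> s; apply/asboolP; apply: tens_refl. Qed.
Lemma tensb_sym : symmetric tensb.
Proof. by move=> s t; apply/asboolP/asboolP => /tens_sym. Qed.
Lemma tensb_trans : transitive tensb.
Proof.
by move=> t s w /asboolP st /asboolP tw; apply/asboolP; apply: tens_trans tw.
Qed.
Canonical tens_equiv := EquivRel tensb tensb_refl tensb_sym tensb_trans.

Definition tensor := {eq_quot tens_equiv}.
HB.instance Definition _ := Choice.on tensor.
Local Notation cls := (\pi_tensor).

Lemma tensor_eqP s t : cls s = cls t <-> tens s t.
Proof. by split=> [/eqmodP/asboolP|st]; [|apply/eqmodP/asboolP]. Qed.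

Lemma tensor_repr s : tens (repr (cls s)) s.
Proof. by apply/tensor_eqP; rewrite reprK. Qed.

Definition fsum_opp (s : fsum) : fsum := [seq (- x.1, x.2) | x <- s].
Definition fsum_mul (s t : fsum) : fsum :=
  [seq (x.1 * y.1, x.2 * y.2) | x <- s, y <- t].

Lemma tens_catl s t t' : tens t t' -> tens (s ++ t) (s ++ t').
Proof. by apply/tens_cat/tens_refl. Qed.
Lemma tens_catr s s' t : tens s s' -> tens (s ++ t) (s' ++ t).
Proof. by move=> st; apply: tens_cat => //; apply: tens_refl. Qed.
Lemma tens_perm s t : perm_eq s t -> tens s t.
Proof.
elim: s t => [|x s IH] t; first by rewrite perm_sym => /perm_nilP->; apply: tens_refl.
move=> xst; have xt : x \in t by rewrite -(perm_mem xst) mem_head.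
case/splitPr: xt xst => t1 t2; rewrite perm_sym (perm_catCA t1 [:: x]) perm_cons.
rewrite perm_sym => /IH st; apply: (@tens_trans _ ([:: x] ++ t1 ++ t2)).
  exact: (@tens_catl [:: x]).
have -> : t1 ++ x :: t2 = (t1 ++ [:: x]) ++ t2 by rewrite -catA.
by rewrite catA; apply/tens_catr/tens_catC.
Qed.

Lemma tens_opp s t : tens s t -> tens (fsum_opp s) (fsum_opp t).
Proof.
elim=> {s t}.
- by move=> s; apply: tens_refl.
- by move=> s t _; apply: tens_sym.
- by move=> s t w _ st _; apply: tens_trans.
- by move=> s s' t t' _ ss' _ tt'; rewrite /fsum_opp !map_cat; apply: tens_cat.
- by move=> s t; rewrite /fsum_opp !map_cat; apply: tens_catC.
- by move=> b; rewrite /= oppr0; apply: tens_0l.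
- by move=> r; apply: tens_0r.
- by move=> r r' b; rewrite /= opprD; apply: tens_addl.
- by move=> r b b'; apply: tens_addr.
- by move=> r a b; rewrite /= -mulNr; apply: tens_bal.
Qed.

Lemma tens_addN s : tens (fsum_opp s ++ s) [::].
Proof.
elim: s => [|x s IH]; first exact: tens_refl.
apply: (@tens_trans _ (([:: (- x.1, x.2)] ++ [:: x]) ++ (fsum_opp s ++ s))).
  by apply: tens_perm; rewrite /= perm_cons -cat1s perm_catCA.
apply: (@tens_cat _ [::] _ [::]) => //; case: x => r b /=.
by apply: tens_trans (tens_0l b); rewrite -(addNr r); apply/tens_sym/tens_addl.
Qed.

Lemma tens_mull x s t :
  tens s t -> tens (fsum_mul [:: x] s) (fsum_mul [:: x] t).
Proof.
rewrite /fsum_mul /= !cats0; elim=> {s t}.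
- by move=> s; apply: tens_refl.
- by move=> s t _; apply: tens_sym.
- by move=> s t w _ st _; apply: tens_trans.
- by move=> s s' t t' _ ss' _ tt'; rewrite !map_cat; apply: tens_cat.
- by move=> s t; rewrite !map_cat; apply: tens_catC.
- by move=> b; rewrite /= mulr0; apply: tens_0l.
- by move=> r; rewrite /= mulr0; apply: tens_0r.
- by move=> r r' b; rewrite /= mulrDr; apply: tens_addl.
- by move=> r b b'; rewrite /= mulrDr; apply: tens_addr.
- move=> r a b; rewrite /= [x.1 * _]mulrA [x.2 * (_ * _)]mulrA -alg_scalarC -[alg_scalar B a * _ * _]mulrA.
  exact: tens_bal.
Qed.

Lemma fsum_mul1 s x : fsum_mul s [:: x] = [seq (y.1 * x.1, y.2 * x.2) | y <- s].
Proof. by elim: s => //= y s <-. Qed.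

Lemma tens_mulr x s t :
  tens s t -> tens (fsum_mul s [:: x]) (fsum_mul t [:: x]).
Proof.
rewrite !fsum_mul1; elim=> {s t}.
- by move=> s; apply: tens_refl.
- by move=> s t _; apply: tens_sym.
- by move=> s t w _ st _; apply: tens_trans.
- by move=> s s' t t' _ ss' _ tt'; rewrite !map_cat; apply: tens_cat.
- by move=> s t; rewrite !map_cat; apply: tens_catC.
- by move=> b; rewrite /= mul0r; apply: tens_0l.
- by move=> r; rewrite /= mul0r; apply: tens_0r.
- by move=> r r' b; rewrite /= mulrDl; apply: tens_addl.
- by move=> r b b'; rewrite /= mulrDl; apply: tens_addr.
- by move=> r a b; rewrite /= mulrAC -[alg_scalar B a * _ * _]mulrA; apply: tens_bal.
Qed.

Lemma fsum_mul_catl s s' t : fsum_mul (s ++ s') t = fsum_mul s t ++ fsum_mul s' t.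
Proof. exact: allpairs_cat. Qed.

Lemma fsum_mul_catr s t t' :
  tens (fsum_mul s (t ++ t')) (fsum_mul s t ++ fsum_mul s t').
Proof. exact/tens_perm/permEl/perm_allpairs_catr. Qed.

Lemma tens_mul s s' t t' :
  tens s s' -> tens t t' -> tens (fsum_mul s t) (fsum_mul s' t').
Proof.
move=> ss' tt'; apply: (@tens_trans _ (fsum_mul s t')).
  elim: s {ss'} => [|x s IH]; first exact: tens_refl.
  by rewrite -cat1s !fsum_mul_catl; apply: tens_cat => //; apply: tens_mull.
elim: t' {tt'} => [|x t' IH].
  by rewrite /fsum_mul !allpairs0r; apply: tens_refl.
rewrite -cat1s; apply: tens_trans (fsum_mul_catr _ _ _) _.
apply: tens_trans (tens_sym (fsum_mul_catr _ _ _)).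
by apply: tens_cat => //; apply: tens_mulr.
Qed.

Definition tensor_opp (x : tensor) := cls (fsum_opp (repr x)).
Definition tensor_add (x y : tensor) := cls (repr x ++ repr y).
Definition tensor_mul (x y : tensor) := cls (fsum_mul (repr x) (repr y)).

Lemma tensor_oppE s : tensor_opp (cls s) = cls (fsum_opp s).
Proof. by apply/tensor_eqP/tens_opp/tensor_repr. Qed.
Lemma tensor_addE s t : tensor_add (cls s) (cls t) = cls (s ++ t).
Proof. by apply/tensor_eqP/tens_cat; apply: tensor_repr. Qed.
Lemma tensor_mulE s t : tensor_mul (cls s) (cls t) = cls (fsum_mul s t).
Proof. by apply/tensor_eqP/tens_mul; apply: tensor_repr. Qed.

Lemma tensor_addA : associative tensor_add.
Proof.
elim/quotW=> s; elim/quotW=> t; elim/quotW=> w.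
by rewrite (tensor_addE t w) (tensor_addE s t) !tensor_addE catA.
Qed.
Lemma tensor_addC : commutative tensor_add.
Proof.
elim/quotW=> s; elim/quotW=> t.
by rewrite !tensor_addE; apply/tensor_eqP/tens_catC.
Qed.
Lemma tensor_add0 : left_id (cls [::]) tensor_add.
Proof. by elim/quotW=> s; rewrite tensor_addE. Qed.
Lemma tensor_addN : left_inverse (cls [::]) tensor_opp tensor_add.
Proof.
elim/quotW=> s; rewrite tensor_oppE tensor_addE.
by apply/tensor_eqP/tens_addN.
Qed.
Lemma tensor_mulA : associative tensor_mul.
Proof.
elim/quotW=> s; elim/quotW=> t; elim/quotW=> w.
rewrite (tensor_mulE t w) (tensor_mulE s t) !tensor_mulE.
congr (cls _); elim: s => [|x s IH] //; rewrite -cat1s !fsum_mul_catl IH.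
congr (_ ++ _); rewrite /fsum_mul /= !cats0 {s IH}.
elim: t => [|y t IH] //=; rewrite map_cat IH -map_comp; congr (_ ++ _).
by apply: eq_map => z; rewrite /= !mulrA.
Qed.
Lemma tensor_mul1l : left_id (cls [:: (1, 1)]) tensor_mul.
Proof.
elim/quotW=> s; rewrite tensor_mulE; congr (cls _); rewrite /fsum_mul /= cats0.
by rewrite -[RHS]map_id; apply: eq_map => -[r b]; rewrite /= !mul1r.
Qed.
Lemma tensor_mul1r : right_id (cls [:: (1, 1)]) tensor_mul.
Proof.
elim/quotW=> s; rewrite tensor_mulE fsum_mul1; congr (cls _).
by rewrite -[RHS]map_id; apply: eq_map => -[r b]; rewrite /= !mulr1.
Qed.
Lemma tensor_mulDl : left_distributive tensor_mul tensor_add.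
Proof.
elim/quotW=> s; elim/quotW=> t; elim/quotW=> w.
rewrite (tensor_addE s t) (tensor_mulE s w) (tensor_mulE t w).
by rewrite tensor_mulE tensor_addE fsum_mul_catl.
Qed.
Lemma tensor_mulDr : right_distributive tensor_mul tensor_add.
Proof.
elim/quotW=> s; elim/quotW=> t; elim/quotW=> w.
rewrite (tensor_addE t w) (tensor_mulE s t) (tensor_mulE s w).
rewrite tensor_mulE tensor_addE.
by apply/tensor_eqP/fsum_mul_catr.
Qed.
HB.instance Definition _ := GRing.isPzRing.Build tensor
  tensor_addA tensor_addC tensor_add0 tensor_addN
  tensor_mulA tensor_mul1l tensor_mul1r tensor_mulDl tensor_mulDr.

Definition tensor_pure (r : R) (b : B) : tensor := cls [:: (r, b)].
Definition tensor_scalar (r : R) : tensor := tensor_pure r 1.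

Lemma tensor_scalar_zmod : zmod_morphism tensor_scalar.
Proof.
move=> r r'; apply/esym; rewrite -[_ - _]/(tensor_add _ (tensor_opp _)).
by rewrite tensor_oppE tensor_addE; apply/tensor_eqP/tens_sym/tens_addl.
Qed.
Lemma tensor_scalar_monoid : monoid_morphism tensor_scalar.
Proof. by split=> // r r'; rewrite [RHS]tensor_mulE /fsum_mul /= mulr1. Qed.
HB.instance Definition _ :=
  GRing.isZmodMorphism.Build R tensor tensor_scalar tensor_scalar_zmod.
HB.instance Definition _ :=
  GRing.isMonoidMorphism.Build R tensor tensor_scalar tensor_scalar_monoid.

Lemma tensor_scalarC r (x : tensor) : tensor_scalar r * x = x * tensor_scalar r.
Proof.
elim/quotW: x => s; rewrite [LHS]tensor_mulE [RHS]tensor_mulE; congr (cls _).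
rewrite fsum_mul1 /fsum_mul /= cats0.
by apply: eq_map => -[r' b]; rewrite /= mul1r mulr1 mulrC.
Qed.

Definition base_change : algebra R :=
  Algebra (alg_scalar := tensor_scalar) tensor_scalarC.

End BaseChange.

(** * Hecke and Yokonuma-Hecke algebras *)

(* The element i : 'I_n.-1 stands for the index i + 1 in {1, ..., n - 1}. *)
Lemma ord_hi_subproof n (i : 'I_n.-1) : (i.+1 < n)%N.
Proof. by rewrite -ltn_predRL. Qed.
Definition ord_lo n (i : 'I_n.-1) : 'I_n := widen_ord (leq_pred n) i.
Definition ord_hi n (i : 'I_n.-1) : 'I_n := Ordinal (ord_hi_subproof i).

Definition far n (i j : 'I_n.-1) : bool := (i.+1 < j)%N || (j.+1 < i)%N.

Section Hecke.
Variables (K : realType) (n : nat).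
Local Notation A := (Cuv K).
Local Notation u := (Cuv_u K).
Local Notation v := (Cuv_v K).
Local Notation T i := (Gen (i : 'I_n.-1) : term A _).

Inductive hecke_rel : term A 'I_n.-1 -> term A 'I_n.-1 -> Prop :=
  | hecke_comm i j : far i j -> hecke_rel (T i * T j) (T j * T i)
  | hecke_braid (i j : 'I_n.-1) : j = i.+1 :> nat ->
      hecke_rel (T i * T j * T i) (T j * T i * T j)
  | hecke_quad i :
      hecke_rel (T i ^+ 2) (Cst (u ^+ 2)%R + Cst v * T i).

Definition hecke : algebra A := presented_algebra hecke_rel.

Variant yok_gen := GenG of 'I_n.-1 | GenT of 'I_n.

Variable d : nat.
Local Notation g i := (Gen (GenG i) : term A yok_gen).
Local Notation t j := (Gen (GenT j) : term A yok_gen).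

(* Since t_{i+1}^d = 1, the power t_{i+1}^{-s} is written t_{i+1}^{d-s}. *)
Definition yok_e (i : 'I_n.-1) : term A yok_gen :=
  (Cst (Cuv_const d%:R^-1%R) *
   \big[@Add A yok_gen/Cst 0]_(0 <= s < d)
     (t (ord_lo i) ^+ s * t (ord_hi i) ^+ (d - s)))%pterm.

Inductive yok_rel : term A yok_gen -> term A yok_gen -> Prop :=
  | yok_comm i j : far i j -> yok_rel (g i * g j) (g j * g i)
  | yok_braid (i j : 'I_n.-1) : j = i.+1 :> nat ->
      yok_rel (g i * g j * g i) (g j * g i * g j)
  | yok_tcomm i j : yok_rel (t i * t j) (t j * t i)
  | yok_gt i j :
      yok_rel (g i * t j) (t (tperm (ord_lo i) (ord_hi i) j) * g i)
  | yok_tpow j : yok_rel (t j ^+ d) (Cst 1)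
  | yok_quad i :
      yok_rel (g i ^+ 2) (Cst (u ^+ 2)%R + Cst v * yok_e i * g i).

Definition yokonuma : algebra A := presented_algebra yok_rel.

End Hecke.
Arguments yokonuma : clear implicits.

Section Compositions.
Variables (d n : nat).

(* The entries of a d-tuple with sum n are at most n. *)
Definition Comp : finType :=
  {mu : {ffun 'I_d -> 'I_n.+1} | \sum_(j < d) mu j == n}%N.

(* mu_1 + ... + mu_k *)
Definition comp_psum (mu : Comp) (k : nat) : nat :=
  (\sum_(j < d | j < k) val mu j)%N.

Definition hecke_parabolic (K : realType) (mu : Comp) : algebra (Cuv K) :=
  generated_subalgebra (B := hecke K n) (fun x =>
    exists i : 'I_n.-1,
      (forall k, (0 < k < d)%N -> i.+1 <> comp_psum mu k) /\
      x = pres_gen (@hecke_rel K n) i).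

End Compositions.

(** * Morita equivalence *)

(* An R-linear equivalence between the categories of left modules over B and C,
   given by a functor, a quasi-inverse and natural isomorphisms. *)
Section Morita.
Variable R : comPzRingType.

Record module_functor (B C : algebra R) := ModuleFunctor {
  mf_obj :> lmodType B -> lmodType C;
  mf_map : forall M N : lmodType B,
    {linear M -> N} -> {linear mf_obj M -> mf_obj N};
  mf_map_id : forall M : lmodType B, mf_map (idfun : {linear M -> M}) =1 id;
  mf_map_comp : forall (M N P : lmodType B)
      (f : {linear N -> P}) (g : {linear M -> N}),
    mf_map (f \o g : {linear M -> P}) =1 mf_map f \o mf_map g;
  mf_map_add : forall (M N : lmodType B) (f g : {linear M -> N}) x,
    mf_map (f \+ g : {linear M -> N}) x = mf_map f x + mf_map g x;
  mf_map_scale : forall (M N : lmodType B) (r : R) (f g : {linear M -> N}),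
    (forall x, g x = alg_scalar B r *: f x) ->
    forall y, mf_map g y = alg_scalar C r *: mf_map f y
}.
Arguments mf_map {B C} F {M N} f : rename.

Definition morita_equivalent (B C : algebra R) : Prop :=
  exists (F : module_functor B C) (G : module_functor C B)
    (eta : forall M : lmodType B, {linear M -> G (F M)})
    (eps : forall N : lmodType C, {linear F (G N) -> N}),
    [/\ forall M, bijective (eta M),
        forall N, bijective (eps N),
        forall (M M' : lmodType B) (f : {linear M -> M'}),
          eta M' \o f =1 mf_map G (mf_map F f) \o eta M
      & forall (N N' : lmodType C) (f : {linear N -> N'}),
          eps N' \o mf_map F (mf_map G f) =1 f \o eps N].

End Morita.

(* Main.v *)
(* Diagonalising the commuting t_j decomposes 1 into idempotents E_chi indexed by
   words chi in {1..d}^n, and g_i exchanges the weights chi and s_i chi.  When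
   chi_i <> chi_(i+1), g_i^2 acts on weight chi as the unit u^2, so every E_chi lies
   in Y E_mu Y, where E_mu is the idempotent of the sorted word of the same content
   mu.  It remains to identify E_mu Y E_mu with H^mu.
   - Adding v times the projection onto the weights with chi_i > chi_(i+1) to g_i
     gives elements of Y satisfying the relations of H_n, hence psi : H_n -> Y; the
     map H^mu -> E_mu Y E_mu is h |-> psi(h) E_mu.
   - It is injective because Y acts on functions from words to H_n by operators in
     which the same correction is subtracted from T_i.
   - It is surjective because Y E_mu is spanned by the z psi(h) E_mu with h in H^mu
     and z a product of u^-1 g_i sorting a word; by the braid relations z does not
     depend on the way the word is sorted.
   The isomorphism and its inverse are A-linear, so they survive extension of
   scalars. *)

Require Import Defs.
From HB Require Import structures.
From mathcomp Require Import all_boot all_order perm all_algebra cyclic separable cyclotomic.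
From mathcomp Require Import boolp reals zify.
From mathcomp.real_closed Require Import complex.

Set Implicit Arguments.
Unset Strict Implicit.
Unset Printing Implicit Defensive.

Import GRing.Theory.
Local Open Scope ring_scope.
Local Open Scope quotient_scope.

(** * Morita equivalence with a full corner *)

(** [hecke_parabolic] is a generated subalgebra of H_n, so a map out of it cannot be prescribed on
    generators unless its relations are known. This is why a map is built on the whole of H_n
    although only its restrictions to the H^mu are used, and why [g i] has to be corrected: at
    positions with equal letters the correction vanishes and psi(T_i) acts as g_i, but elsewhere g_i
    alone violates the Hecke relations. For the same reason the function module takes values in H_n
    itself: injectivity becomes an evaluation at one word, and no basis of H_n or of Y enters. The
    morphism [theta] is arbitrary, and tensoring along it may destroy injectivity. Each corner map
    therefore comes with an additive, A-linear retraction defined on all of Y; identities between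
    such maps do pass to R. Everything that is inverted (d, u) and the root of unity zeta already
    live in A, so all computations with weights are made before the change of base. *)

Section Corner.
Variables (R : comPzRingType) (B C : algebra R) (phi : C -> B).
Hypothesis phi_add : {morph phi : x y / x + y}.
Hypothesis phi_mul : {morph phi : x y / x * y}.
Hypothesis phi_scalar : forall r, phi (alg_scalar C r) = alg_scalar B r * phi 1.

Let phi_1l c : phi 1 * phi c = phi c. Proof. by rewrite -phi_mul mul1r. Qed.
Let phi_1r c : phi c * phi 1 = phi c. Proof. by rewrite -phi_mul mulr1. Qed.

(** * The functor M |-> eM, where e is the idempotent [phi 1] *)

Section Restriction.
Variable M : lmodType B.

Definition in_corner (x : M) : bool := phi 1 *: x == x.
Definition corner := {x : M | in_corner x}.
HB.instance Definition _ := SubChoice.on corner.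

Lemma corner_zmod : zmod_closed in_corner.
Proof.
split=> [|x y]; first by apply/eqP; rewrite scaler0.
by move=> /eqP xE /eqP yE; apply/eqP; rewrite scalerBr xE yE.
Qed.
HB.instance Definition _ := GRing.SubChoice_isSubZmodule.Build M _ corner corner_zmod.

Lemma phi1_corner (x : corner) : phi 1 *: val x = val x.
Proof. exact/eqP/(valP x). Qed.

Lemma corner_scale_subproof c (x : M) : in_corner (phi c *: x).
Proof. by rewrite /in_corner scalerA phi_1l. Qed.

Definition corner_scale (c : C) (x : corner) : corner :=
  Sub (phi c *: val x) (corner_scale_subproof c (val x)).

Lemma corner_scaleA a b (x : corner) :
  corner_scale a (corner_scale b x) = corner_scale (a * b) x.
Proof. by apply: val_inj; rewrite /= scalerA phi_mul. Qed.
Lemma corner_scale1 : left_id 1 corner_scale.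
Proof. by move=> x; apply: val_inj; rewrite /= phi1_corner. Qed.
Lemma corner_scaleDr : right_distributive corner_scale +%R.
Proof. by move=> c x y; apply: val_inj; rewrite /= scalerDr. Qed.
Lemma corner_scaleDl x : {morph corner_scale^~ x : a b / a + b}.
Proof. by move=> a b; apply: val_inj; rewrite /= phi_add scalerDl. Qed.
HB.instance Definition _ := GRing.Zmodule_isLmodule.Build C corner
  corner_scaleA corner_scale1 corner_scaleDr corner_scaleDl.

End Restriction.

Section RestrictionMap.
Variables (M N : lmodType B) (f : {linear M -> N}).

Lemma corner_map_subproof (x : corner M) : in_corner (f (val x)).
Proof. by rewrite /in_corner -linearZ phi1_corner. Qed.
Definition corner_map (x : corner M) : corner N :=
  Sub (f (val x)) (corner_map_subproof x).
Lemma corner_map_linear : linear corner_map.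
Proof. by move=> c x y; apply: val_inj; rewrite /= linearP. Qed.
HB.instance Definition _ :=
  GRing.isLinear.Build C (corner M) (corner N) _ corner_map corner_map_linear.
End RestrictionMap.

Definition corner_functor : module_functor B C.
Proof.
apply: (@ModuleFunctor R B C corner (fun M N f => corner_map f)).
- by move=> M x; apply: val_inj.
- by move=> M N P f g x; apply: val_inj.
- by move=> M N f g x; apply: val_inj.
- move=> M N r f g fg x; apply: val_inj; rewrite /= fg phi_scalar -scalerA.
  by rewrite (eqP (corner_map_subproof f x)).
(* Transparent: the unit and counit are typed against [corner] and [coind] themselves, so the
   functors have to unfold. *)
Defined.

(** * The quasi-inverse N |-> Hom_C(eB, N) *)

Section Coinduction.
Variable N : lmodType C.

(* The module of C-linear maps from [phi 1 * B] to N: such a map is recovered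
   from its composite with [b |-> phi 1 * b]. *)
Definition is_coind (f : B -> N) : Prop :=
  {morph f : x y / x + y} /\ forall c x, f (phi c * x) = c *: f x.
Definition coind := {f : B -> N | is_coind f}.
HB.instance Definition _ := gen_eqMixin coind.
HB.instance Definition _ := gen_choiceMixin coind.

Definition coind_fun (f : coind) : B -> N := sval f.
Coercion coind_fun : coind >-> Funclass.

Lemma coindP (f g : coind) : f =1 g -> f = g.
Proof. by case: f g => f fP [g gP] fg; apply/eq_exist/functional_extensionality_dep. Qed.
Lemma coindD (f : coind) : {morph f : x y / x + y}.
Proof. by case: (svalP f). Qed.
Lemma coindM (f : coind) c x : f (phi c * x) = c *: f x.
Proof. by case: (svalP f). Qed.

Lemma coind0_subproof : is_coind (fun=> 0).
Proof. by split=> [x y|c x]; rewrite ?addr0 ?scaler0. Qed.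
Lemma coindN_subproof (f : coind) : is_coind (fun x => - f x).
Proof. by split=> [x y|c x]; rewrite ?coindD ?coindM ?opprD ?scalerN. Qed.
Lemma coindD_subproof (f g : coind) : is_coind (fun x => f x + g x).
Proof. by split=> [x y|c x]; rewrite ?coindD ?coindM ?scalerDr // addrACA. Qed.
Lemma coindZ_subproof b (f : coind) : is_coind (fun x => f (x * b)).
Proof. by split=> [x y|c x]; rewrite ?mulrDl ?coindD // -mulrA coindM. Qed.

Definition coind0 : coind := exist _ _ coind0_subproof.
Definition coind_opp (f : coind) : coind := exist _ _ (coindN_subproof f).
Definition coind_add (f g : coind) : coind := exist _ _ (coindD_subproof f g).
Definition coind_scale (b : B) (f : coind) : coind := exist _ _ (coindZ_subproof b f).

Lemma coind_addA : associative coind_add.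
Proof. by move=> f g h; apply: coindP => x; apply: addrA. Qed.
Lemma coind_addC : commutative coind_add.
Proof. by move=> f g; apply: coindP => x; apply: addrC. Qed.
Lemma coind_add0 : left_id coind0 coind_add.
Proof. by move=> f; apply: coindP => x; apply: add0r. Qed.
Lemma coind_addN : left_inverse coind0 coind_opp coind_add.
Proof. by move=> f; apply: coindP => x; apply: addNr. Qed.
HB.instance Definition _ := GRing.isZmodule.Build coind
  coind_addA coind_addC coind_add0 coind_addN.

Lemma coind_scaleA a b f : coind_scale a (coind_scale b f) = coind_scale (a * b) f.
Proof. by apply: coindP => x; rewrite /= /coind_fun /= mulrA. Qed.
Lemma coind_scale1 : left_id 1 coind_scale.
Proof. by move=> f; apply: coindP => x; rewrite /= /coind_fun /= mulr1. Qed.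
Lemma coind_scaleDr : right_distributive coind_scale +%R.
Proof. by move=> b f g; apply: coindP. Qed.
Lemma coind_scaleDl f : {morph coind_scale^~ f : a b / a + b}.
Proof. move=> a b; apply: coindP => x.
exact: etrans (congr1 f (mulrDr x a b)) (coindD f _ _). Qed.
HB.instance Definition _ := GRing.Zmodule_isLmodule.Build B coind
  coind_scaleA coind_scale1 coind_scaleDr coind_scaleDl.

End Coinduction.

Section CoinductionMap.
Variables (M N : lmodType C) (g : {linear M -> N}).

Lemma coind_map_subproof (f : coind M) : is_coind (fun x => g (f x)).
Proof. by split=> [x y|c x]; rewrite ?coindD ?coindM ?linearD ?linearZ. Qed.
Definition coind_map (f : coind M) : coind N := exist _ _ (coind_map_subproof f).
Lemma coind_map_linear : linear coind_map.
Proof. by move=> b f f'; apply: coindP => x; apply: linearD. Qed.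
HB.instance Definition _ :=
  GRing.isLinear.Build B (coind M) (coind N) _ coind_map coind_map_linear.
End CoinductionMap.

(** For a full idempotent e, both Hom_C(eB, -) and the tensor product with Be over C are
    quasi-inverse to M |-> eM. The former is a set of functions and needs no quotient. *)
Definition coind_functor : module_functor C B.
Proof.
apply: (@ModuleFunctor R C B coind (fun M N f => coind_map f)).
- by move=> M x; apply: coindP.
- by move=> M N P f g x; apply: coindP.
- by move=> M N f g x; apply: coindP => b.
- move=> M N r f g fg h; apply: coindP => x.
  transitivity (f (coind_fun h (x * alg_scalar B r))); last by [].
  (* The scalar is moved into the argument of [h], where it is central; the factor [phi 1] that
     comes with it is absorbed by C-linearity at 1. *)
  rewrite [LHS]fg -linearZ -coindM phi_scalar; congr (f _).
  by rewrite alg_scalarC -mulrA coindM scale1r alg_scalarC.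
Defined.

Hypothesis phi_inj : injective phi.
Hypothesis phi_corner : forall b, exists c, phi c = phi 1 * b * phi 1.
Hypothesis phi_full : exists s : seq (B * B), \sum_(p <- s) p.1 * phi 1 * p.2 = 1.

Let unphi b : C := projT1 (cid (phi_corner b)).
Let unphiP b : phi (unphi b) = phi 1 * b * phi 1.
Proof. by rewrite /unphi; case: cid. Qed.

Section Unit.
Variable M : lmodType B.

Lemma corner_unit_subproof1 (m : M) b : in_corner (phi 1 *: (b *: m)).
Proof. by rewrite /in_corner scalerA phi_1l. Qed.
Lemma corner_unit_subproof2 (m : M) :
  is_coind (fun b => Sub _ (corner_unit_subproof1 m b) : corner M).
Proof.
split=> [x y|c x]; apply: val_inj => /=; first by rewrite scalerDl scalerDr.
by rewrite !scalerA !mulrA phi_1l phi_1r.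
Qed.
Definition corner_unit (m : M) : coind (corner M) := exist _ _ (corner_unit_subproof2 m).
Lemma corner_unit_linear : linear corner_unit.
Proof.
move=> b x y; apply: coindP => z; apply: val_inj.
by rewrite /= !scalerDr !scalerA !mulrA.
Qed.
HB.instance Definition _ :=
  GRing.isLinear.Build B M (coind (corner M)) _ corner_unit corner_unit_linear.

(** Fullness provides the inverse: if 1 is the sum of the p.1 e p.2, then m is the sum of the p.1 (e
    p.2 m), so m is recovered from b |-> e b m. *)
Lemma corner_unit_bij : bijective corner_unit.
Proof.
have [s s1] := phi_full.
pose inv (f : coind (corner M)) : M := \sum_(p <- s) p.1 *: val (coind_fun f p.2).
exists inv => [m|f].
  rewrite /inv -[RHS]scale1r -s1 scaler_suml; apply: eq_bigr => p _.
  by rewrite /= !scalerA.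
apply: coindP => x; apply: val_inj; rewrite /= /inv !scaler_sumr.
have f0 : f 0 = 0 by apply: (addrI (f 0)); rewrite -coindD !addr0.
(* Each e x p.1 e lies in eBe, the image of [phi], so C-linearity of [f] takes it out as a
   scalar. *)
have -> : f x = \sum_(p <- s) f (phi 1 * (x * p.1) * phi 1 * p.2).
  rewrite -[LHS]scale1r -coindM -[X in coind_fun f X]mulr1 -s1.
  rewrite mulr_sumr (big_morph _ (coindD f) f0); apply: eq_bigr => p _.
  by rewrite !mulrA.
rewrite (big_morph (\val : corner M -> M) (raddfD _) (raddf0 _)); apply: eq_bigr => p _.
by rewrite -unphiP coindM /= unphiP -[in LHS](phi1_corner (coind_fun f p.2)) !scalerA !mulrA.
Qed.

End Unit.

Section Counit.
Variable N : lmodType C.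

Definition corner_counit (f : corner (coind N)) : N := coind_fun (val f) 1.
Lemma corner_counit_linear : linear corner_counit.
Proof.
move=> c f g; rewrite /corner_counit /= /coind_fun /= -!/(coind_fun _) mul1r.
by rewrite -[phi c]mulr1 coindM.
Qed.
HB.instance Definition _ :=
  GRing.isLinear.Build C (corner (coind N)) N _ corner_counit corner_counit_linear.

(** The inverse sends n to b |-> c n, where c is the element of C with phi c = e b e; its uniqueness
    makes this additive and C-linear in b. *)
Lemma corner_counit_bij : bijective corner_counit.
Proof.
have unphiD n : is_coind (fun b => unphi b *: n : N).
  split=> [x y|c x].
    by rewrite -scalerDl; congr (_ *: _); apply: phi_inj; rewrite phi_add !unphiP mulrDr mulrDl.
  rewrite scalerA; congr (_ *: _); apply: phi_inj.
  by rewrite phi_mul !unphiP !mulrA phi_1l phi_1r.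
have ucorner n : in_corner (exist _ _ (unphiD n) : coind N).
  apply/eqP/coindP => b; rewrite /coind_fun /=; congr (_ *: _); apply: phi_inj.
  by rewrite !unphiP -!mulrA phi_1l.
exists (fun n => Sub _ (ucorner n)) => [f|n].
  apply/val_inj/coindP => b; rewrite /= {1}/coind_fun /= /corner_counit -coindM unphiP mulr1.
  rewrite -[X in _ = coind_fun X b]phi1_corner /= {2}/coind_fun /=.
  by rewrite -[LHS]/(coind_fun _ _) -mulrA coindM scale1r.
rewrite /corner_counit /= /coind_fun /= -[RHS]scale1r; congr (_ *: _).
by apply: phi_inj; rewrite unphiP mulr1 phi_1l.
Qed.

End Counit.

Lemma corner_morita : morita_equivalent B C.
Proof.
exists corner_functor, coind_functor, (fun M => corner_unit (M := M) : {linear _ -> _}).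
exists (fun N => corner_counit (N := N) : {linear _ -> _}).
split.
- exact: corner_unit_bij.
- exact: corner_counit_bij.
- move=> M M' f m; apply/coindP => b; apply: val_inj.
  by rewrite /= -!linearZ.
- by [].
Qed.

End Corner.

(** * Presented algebras *)

Section TermEval.
Variables (R : comPzRingType) (X : Type) (D : algebra R) (f : X -> D).

Fixpoint eval (t : term R X) : D :=
  match t with
  | Gen x => f x
  | Cst a => alg_scalar D a
  | Add s t => eval s + eval t
  | Mul s t => eval s * eval t
  end.

Lemma eval_Exp t k : eval (t ^+ k)%pterm = eval t ^+ k.
Proof. by elim: k => [|k IH]; rewrite ?expr0 ?exprS /= ?rmorph1 // -IH. Qed.

Lemma eval_sum I (r : seq I) (F : I -> term R X) :
  eval (\big[@Add R X/Cst 0]_(i <- r) F i) = \sum_(i <- r) eval (F i).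
Proof. by elim: r => [|i r IH]; rewrite ?big_nil ?big_cons /= ?rmorph0 ?IH. Qed.

End TermEval.

Section Presented.
Variables (R : comPzRingType) (X : Type) (rel : term R X -> term R X -> Prop).
Local Notation P := (presented_algebra rel).

Lemma eval_pres_gen t : eval (pres_gen rel) t = \pi_(presented rel) t.
Proof.
elim: t => //= s -> t ->; first exact: (pres_addE rel s t).
exact: (pres_mulE rel s t).
Qed.

Lemma pres_gen_rel s t : rel s t -> eval (pres_gen rel) s = eval (pres_gen rel) t.
Proof. by move=> st; rewrite !eval_pres_gen; apply/pres_eqP/congr_rel. Qed.

Lemma pres_ind (Q : P -> Prop) :
  (forall x, Q (pres_gen rel x)) -> (forall a, Q (alg_scalar P a)) ->
  (forall x y, Q x -> Q y -> Q (x + y)) -> (forall x y, Q x -> Q y -> Q (x * y)) ->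
  forall x, Q x.
Proof.
move=> Qg Qs Qa Qm; elim/quotW=> t; rewrite -eval_pres_gen.
by elim: t => //= s Qs' t Qt; [apply: Qa|apply: Qm].
Qed.

Section Lift.
Variables (D : algebra R) (f : X -> D).
Hypothesis f_rel : forall s t, rel s t -> eval f s = eval f t.

Lemma eval_congr s t : congr rel s t -> eval f s = eval f t.
Proof.
elim=> {s t} //=.
- by move=> s t w _ -> _ ->.
- by move=> s s' t t' _ -> _ ->.
- by move=> s s' t t' _ -> _ ->.
- by move=> s t w; rewrite addrA.
- by move=> s t; rewrite addrC.
- by move=> t; rewrite rmorph0 add0r.
- by move=> t; rewrite rmorphN1 rmorph0 mulN1r addNr.
- by move=> s t w; rewrite mulrA.
- by move=> t; rewrite rmorph1 mul1r.
- by move=> s t w; rewrite mulrDl.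
- by move=> s t w; rewrite mulrDr.
- by move=> a b; rewrite rmorphD.
- by move=> a b; rewrite rmorphM.
- by move=> a t; rewrite alg_scalarC.
Qed.

(* The unused argument, here and in [pres_module] and [bc_lift], lets the
   canonical structures declared below recover the proof they depend on. *)
Definition pres_lift of (forall s t, rel s t -> eval f s = eval f t) :=
  fun x : P => eval f (repr x).
Local Notation lift := (pres_lift f_rel).

Lemma pres_lift_eval t : lift (eval (pres_gen rel) t) = eval f t.
Proof. by rewrite eval_pres_gen; apply/eval_congr/pres_repr. Qed.

Lemma pres_lift_zmod : zmod_morphism lift.
Proof.
have liftD : {morph lift : x y / x + y}.
  elim/quotW=> s; elim/quotW=> t; rewrite -!eval_pres_gen !pres_lift_eval.
  exact: (pres_lift_eval (s + t)%pterm).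
by move=> x y; apply: (addIr (lift y)); rewrite -liftD !subrK.
Qed.
Lemma pres_lift_monoid : monoid_morphism lift.
Proof.
split; first by rewrite -(rmorph1 (alg_scalar P)) (pres_lift_eval (Cst 1)) /= rmorph1.
elim/quotW=> s; elim/quotW=> t; rewrite -!eval_pres_gen !pres_lift_eval.
exact: (pres_lift_eval (s * t)%pterm).
Qed.
HB.instance Definition _ := GRing.isZmodMorphism.Build P D lift pres_lift_zmod.
HB.instance Definition _ := GRing.isMonoidMorphism.Build P D lift pres_lift_monoid.

Lemma pres_lift_gen x : lift (pres_gen rel x) = f x.
Proof. exact: (pres_lift_eval (Gen x)). Qed.
Lemma pres_lift_scalar a : lift (alg_scalar P a) = alg_scalar D a.
Proof. exact: (pres_lift_eval (Cst a)). Qed.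

End Lift.

Section Action.
Variables (V : lmodType R) (f : X -> {linear V -> V}).

(** Terms act on [V] directly rather than through an algebra of endomorphisms, so that relations can
    be checked vector by vector. *)
Fixpoint act (t : term R X) (z : V) : V :=
  match t with
  | Gen x => f x z
  | Cst a => a *: z
  | Add s t => act s z + act t z
  | Mul s t => act s (act t z)
  end.

Lemma act_linear t : linear (act t).
Proof.
elim: t => [x|a|s IHs t IHt|s IHs t IHt] a' y z /=.
- exact: linearP.
- by rewrite scalerDr !scalerA mulrC.
- by rewrite IHs IHt scalerDr addrACA.
- by rewrite IHt IHs.
Qed.

HB.instance Definition _ t := GRing.isLinear.Build R V V _ (act t) (act_linear t).

Lemma act_Exp t k z : act (t ^+ k)%pterm z = iter k (act t) z.
Proof. by elim: k => [|k IH] /=; rewrite ?scale1r // -IH. Qed.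

Lemma act_sum I (r : seq I) (F : I -> term R X) z :
  act (\big[@Add R X/Cst 0]_(i <- r) F i) z = \sum_(i <- r) act (F i) z.
Proof. by elim: r => [|i r IH]; rewrite ?big_nil ?big_cons /= ?scale0r ?IH. Qed.

Hypothesis f_rel : forall s t, rel s t -> act s =1 act t.

Lemma act_congr s t : congr rel s t -> act s =1 act t.
Proof.
elim=> {s t} //=.
- by move=> s t _ st z; rewrite st.
- by move=> s t w _ st _ tw z; rewrite st tw.
- by move=> s s' t t' _ st _ st' z; rewrite /= st st'.
- by move=> s s' t t' _ st _ st' z; rewrite /= st st'.
- by move=> s t w z; rewrite /= addrA.
- by move=> s t z; rewrite /= addrC.
- by move=> t z; rewrite /= scale0r add0r.
- by move=> t z; rewrite /= scaleN1r addNr scale0r.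
- by move=> t z; rewrite /= scale1r.
- by move=> s t w z /=; rewrite raddfD.
- by move=> a b z; rewrite /= scalerDl.
- by move=> a b z; rewrite /= scalerA.
- by move=> a t z /=; rewrite linearZ.
Qed.

Definition pres_module of (forall s t, rel s t -> act s =1 act t) : Type := V.
Local Notation PV := (pres_module f_rel).
HB.instance Definition _ := GRing.Zmodule.on PV.

Definition pres_scale (x : P) (z : PV) : PV := act (repr x) z.

Lemma pres_scaleE t z : pres_scale (eval (pres_gen rel) t) z = act t z.
Proof. by rewrite eval_pres_gen; apply/act_congr/pres_repr. Qed.

Lemma pres_scaleA x y z : pres_scale x (pres_scale y z) = pres_scale (x * y) z.
Proof.
move: x y; elim/quotW=> s; elim/quotW=> t; rewrite -!eval_pres_gen !pres_scaleE.
by rewrite (pres_scaleE (s * t)%pterm).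
Qed.
Lemma pres_scale1 : left_id 1 pres_scale.
Proof.
move=> z; rewrite -(rmorph1 (alg_scalar P)) (pres_scaleE (Cst 1)) /=.
by rewrite scale1r.
Qed.
Lemma pres_scaleDr : right_distributive pres_scale +%R.
Proof.
by move=> x y z; rewrite /pres_scale -raddfD.
Qed.
Lemma pres_scaleDl z : {morph pres_scale^~ z : x y / x + y}.
Proof.
elim/quotW=> s; elim/quotW=> t; rewrite -!eval_pres_gen !pres_scaleE.
by rewrite (pres_scaleE (s + t)%pterm).
Qed.
HB.instance Definition _ := GRing.Zmodule_isLmodule.Build P PV
  pres_scaleA pres_scale1 pres_scaleDr pres_scaleDl.

Lemma pres_module_gen x (z : PV) : pres_gen rel x *: z = f x z.
Proof. exact: (pres_scaleE (Gen x)). Qed.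
Lemma pres_module_scalar a (z : PV) : alg_scalar P a *: z = (a *: (z : V)).
Proof. exact: (pres_scaleE (Cst a)). Qed.

End Action.
End Presented.

(** * Maps out of an extension of scalars *)

Section BaseChange.
Variables (A R : comPzRingType) (theta : {rmorphism A -> R}) (B : algebra A).
Local Notation RB := (base_change theta B).
Local Notation pure := (@tensor_pure A R theta B).

Lemma tensor_ind (Q : RB -> Prop) :
  Q 0 -> (forall x y, Q x -> Q y -> Q (x + y)) -> (forall r b, Q (pure r b)) ->
  forall x, Q x.
Proof.
move=> Q0 QD Qp; elim/quotW; elim=> [|[r b] s IH] //.
suff -> : \pi_(tensor theta B) ((r, b) :: s) = pure r b + \pi_(tensor theta B) s.
  exact: QD.
exact: (esym (tensor_addE theta [:: (r, b)] s)).
Qed.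

Lemma pureM r r' b b' : pure r b * pure r' b' = pure (r * r') (b * b').
Proof. exact: (tensor_mulE theta [:: (r, b)] [:: (r', b')]). Qed.
Lemma pureDr r b b' : pure r (b + b') = pure r b + pure r b'.
Proof.
by apply/esym/(etrans (tensor_addE theta [:: (r, b)] [:: (r, b')]))/tensor_eqP/tens_sym/tens_addr.
Qed.
Lemma pure0r r : pure r 0 = 0.
Proof. by apply: (addrI (pure r 0)); rewrite -pureDr !addr0. Qed.
Lemma pure_sum r I (s : seq I) (F : I -> B) :
  pure r (\sum_(i <- s) F i) = \sum_(i <- s) pure r (F i).
Proof. exact: (big_morph _ (pureDr r) (pure0r r)). Qed.
Lemma scalar_pure r r' b : alg_scalar RB r * pure r' b = pure (r * r') b.
Proof. by rewrite [LHS]pureM mul1r. Qed.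
Lemma pure_scalar r a b : pure r (alg_scalar B a * b) = pure (r * theta a) b.
Proof. by apply/tensor_eqP/tens_sym/tens_bal. Qed.

Section Lift.
Variables (D : algebra R) (f : {additive B -> D}).
Hypothesis f_scalar : forall a b, f (alg_scalar B a * b) = alg_scalar D (theta a) * f b.

Definition fsum_lift (s : seq (R * B)) : D :=
  \sum_(x <- s) alg_scalar D x.1 * f x.2.

Lemma fsum_lift_tens s t : tens theta s t -> fsum_lift s = fsum_lift t.
Proof.
rewrite /fsum_lift; elim=> {s t} //.
- by move=> s t w _ -> _ ->.
- by move=> s s' t t' _ ss' _ tt'; rewrite !big_cat ss' tt'.
- by move=> s t; rewrite !big_cat /= addrC.
- by move=> b; rewrite big_seq1 big_nil rmorph0 mul0r.
- by move=> r; rewrite big_seq1 big_nil raddf0 mulr0.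
- by move=> r r' b; rewrite big_seq1 big_cons big_seq1 rmorphD mulrDl.
- by move=> r b b'; rewrite big_seq1 big_cons big_seq1 raddfD mulrDr.
- by move=> r a b; rewrite !big_seq1 rmorphM f_scalar mulrA.
Qed.

Definition bc_lift
    of (forall a b, f (alg_scalar B a * b) = alg_scalar D (theta a) * f b) :=
  fun x : RB => fsum_lift (repr x).
Local Notation lift := (bc_lift f_scalar).

Lemma bc_liftE s : lift (\pi_(tensor theta B) s) = fsum_lift s.
Proof. exact/fsum_lift_tens/tensor_repr. Qed.

Lemma bc_lift_pure r b : lift (pure r b) = alg_scalar D r * f b.
Proof. by rewrite bc_liftE /fsum_lift big_seq1. Qed.

Lemma bc_lift_zmod : zmod_morphism lift.
Proof.
have liftD : {morph lift : x y / x + y}.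
  elim/quotW=> s; elim/quotW=> t; rewrite [X in lift X](tensor_addE theta s t).
  by rewrite !bc_liftE /fsum_lift big_cat.
by move=> x y; apply: (addIr (lift y)); rewrite -liftD !subrK.
Qed.
HB.instance Definition _ := GRing.isZmodMorphism.Build RB D lift bc_lift_zmod.

Lemma bc_lift_scalar r x : lift (alg_scalar RB r * x) = alg_scalar D r * lift x.
Proof.
elim/tensor_ind: x => [|x y IHx IHy|r' b].
- by rewrite mulr0 raddf0 mulr0.
- by rewrite mulrDr !raddfD mulrDr /= IHx IHy.
- by rewrite scalar_pure !bc_lift_pure rmorphM mulrA.
Qed.

Lemma bc_liftM : {morph f : x y / x * y} -> {morph lift : x y / x * y}.
Proof.
move=> fM x y; elim/tensor_ind: x => [|x x' IHx IHx'|r b].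
- by rewrite mul0r raddf0 mul0r.
- by rewrite mulrDl !raddfD mulrDl /= IHx IHx'.
elim/tensor_ind: y => [|y y' IHy IHy'|r' b'].
- by rewrite mulr0 raddf0 mulr0.
- by rewrite mulrDr !raddfD mulrDr /= IHy IHy'.
rewrite pureM !bc_lift_pure rmorphM fM -!mulrA; congr (_ * _).
by rewrite !mulrA alg_scalarC.
Qed.

End Lift.
End BaseChange.

#[local] Arguments alg_scalar : simpl never.

(** * Orthogonal corners *)

Section OrthogonalCorners.
Variables (A R : comPzRingType) (theta : {rmorphism A -> R}) (Y : algebra A).
Variables (I : finType) (B : I -> algebra A).
Variables (phi : forall i, {additive B i -> Y}) (lam : forall i, {additive Y -> B i}).
Hypothesis phiM : forall i, {morph phi i : x y / x * y}.
Hypothesis phiZ : forall i a x, phi i (alg_scalar (B i) a * x) = alg_scalar Y a * phi i x.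
Hypothesis lamZ : forall i a y, lam i (alg_scalar Y a * y) = alg_scalar (B i) a * lam i y.
Hypothesis phiK : forall i, cancel (phi i) (lam i).
Hypothesis lamK : forall i y, phi i (lam i y) = phi i 1 * y * phi i 1.
Hypothesis phi_orth : forall i j y, i != j -> phi i 1 * y * phi j 1 = 0.
Hypothesis phi_full : exists (J : finType) (k : J -> I) (p : J -> Y * Y),
  \sum_j (p j).1 * phi (k j) 1 * (p j).2 = 1.

Local Notation RY := (base_change theta Y).
Local Notation RB i := (base_change theta (B i)).
Local Notation pure := (tensor_pure theta).

Definition phi_pure i (x : B i) : RY := pure 1 (phi i x).
Lemma phi_pure_zmod i : zmod_morphism (@phi_pure i).
Proof.
move=> x y; apply: (addIr (phi_pure y)).
by rewrite -[LHS]pureDr -raddfD !subrK.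
Qed.
HB.instance Definition _ i :=
  GRing.isZmodMorphism.Build (B i) RY (@phi_pure i) (@phi_pure_zmod i).

Lemma phi_pureZ i a x :
  phi_pure (alg_scalar (B i) a * x) = alg_scalar RY (theta a) * phi_pure x.
Proof. by rewrite /phi_pure phiZ pure_scalar scalar_pure mul1r mulr1. Qed.

Definition lam_pure i (y : Y) : RB i := pure 1 (lam i y).
Lemma lam_pure_zmod i : zmod_morphism (lam_pure i).
Proof.
move=> x y; apply: (addIr (lam_pure i y)).
by rewrite -[LHS]pureDr -raddfD !subrK.
Qed.
HB.instance Definition _ i :=
  GRing.isZmodMorphism.Build Y (RB i) (lam_pure i) (lam_pure_zmod i).

Lemma lam_pureZ i a y :
  lam_pure i (alg_scalar Y a * y) = alg_scalar (RB i) (theta a) * lam_pure i y.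
Proof. by rewrite /lam_pure lamZ pure_scalar scalar_pure mul1r mulr1. Qed.

Local Notation Rphi i := (bc_lift (@phi_pureZ i)).
Local Notation Rlam i := (bc_lift (lam_pureZ i)).

Lemma Rphi_pure i r x : Rphi i (pure r x) = pure r (phi i x).
Proof. by rewrite bc_lift_pure scalar_pure mulr1. Qed.
Lemma Rlam_pure i r y : Rlam i (pure r y) = pure r (lam i y).
Proof. by rewrite bc_lift_pure scalar_pure mulr1. Qed.

Lemma Rphi1 i : Rphi i 1 = pure 1 (phi i 1). Proof. exact: Rphi_pure. Qed.

Lemma RphiM i : {morph Rphi i : x y / x * y}.
Proof. by apply: bc_liftM => x y; rewrite /= /phi_pure phiM pureM mulr1. Qed.

Lemma phi_orth2 i j x y : i != j -> phi i x * phi j y = 0.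
Proof.
move=> ij; rewrite -[x]mulr1 -[y]mul1r !phiM mulrA -[phi i x * _ * _]mulrA.
by rewrite -[phi i 1]mulr1 phi_orth // mulr0 mul0r.
Qed.

(** By [phiK] and [lamK], [lam i] only sees e_i y e_i, and e_i annihilates the image of [phi j]. *)
Lemma lam_phi_orth i j x : i != j -> lam i (phi j x) = 0.
Proof.
move=> ij; rewrite -[LHS]phiK lamK -[X in lam i X]mulrA phi_orth2 1?eq_sym // mulr0.
by rewrite raddf0.
Qed.

Lemma Rphi_orth i j x y : i != j -> Rphi i x * Rphi j y = 0.
Proof.
move=> ij; elim/tensor_ind: x => [|x x' Ex Ex'|r x].
- by rewrite raddf0 mul0r.
- by rewrite raddfD mulrDl /= Ex Ex' addr0.
elim/tensor_ind: y => [|y y' Ey Ey'|s y].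
- by rewrite raddf0 mulr0.
- by rewrite raddfD mulrDr /= Ey Ey' addr0.
by rewrite !Rphi_pure pureM phi_orth2 // pure0r.
Qed.

(** This is where the retraction pays off: injectivity of [phi i] alone could be lost over R, but
    the identity [phiK] is inherited. *)
Lemma RphiK i : cancel (Rphi i) (Rlam i).
Proof.
elim/tensor_ind=> [|x y Ex Ey|r x].
- by rewrite !raddf0.
- by rewrite !raddfD /= Ex Ey.
- by rewrite Rphi_pure Rlam_pure phiK.
Qed.

Lemma Rlam_orth i j x : i != j -> Rlam i (Rphi j x) = 0.
Proof.
move=> ij; elim/tensor_ind: x => [|x y Ex Ey|r x].
- by rewrite !raddf0.
- by rewrite !raddfD /= Ex Ey addr0.
- by rewrite Rphi_pure Rlam_pure lam_phi_orth // pure0r.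
Qed.

Local Notation C := (direct_sum (fun i => RB i)).

Definition corners_sum (c : C) : RY := \sum_i Rphi i (c i).

Lemma corners_sum1 : corners_sum 1 = pure 1 (\sum_i phi i 1).
Proof. by rewrite pure_sum; apply: eq_bigr => i _; apply: Rphi1. Qed.

(** For e the sum of the e_i, the off-diagonal blocks e_i Y e_j vanish, so the corner eYe is the
    direct sum of the e_i Y e_i and [corner_morita] applies to e. *)
Lemma orthogonal_corners_morita : morita_equivalent RY C.
Proof.
apply: (@corner_morita R RY C corners_sum).
- move=> c c'; rewrite /corners_sum -big_split; apply: eq_bigr => i _.
  exact: (raddfD (Rphi i)).
- move=> c c'; rewrite /corners_sum big_distrlr; apply: eq_bigr => i _.
  rewrite (bigD1 i) //= [X in _ + X]big1 ?addr0; first exact: RphiM.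
  by move=> j ji; rewrite Rphi_orth // eq_sym.
- move=> r; rewrite /corners_sum mulr_sumr; apply: eq_bigr => i _.
  rewrite -(bc_lift_scalar (@phi_pureZ i)); congr (Rphi i _).
  exact: esym (mulr1 _).
- move=> c c' e; apply: functional_extensionality_dep => i.
  have inv (b : C) : b i = Rlam i (corners_sum b).
    rewrite /corners_sum raddf_sum (bigD1 i) //= RphiK big1 ?addr0 // => j ji.
    by rewrite Rlam_orth // eq_sym.
  by rewrite inv e -inv.
- move=> b; rewrite corners_sum1; elim/tensor_ind: b => [|b b' [c Ec] [c' Ec']|r y].
  + exists 0; rewrite mulr0 mul0r /corners_sum big1 // => i _.
    exact: (raddf0 (Rphi i)).
  + exists (c + c'); rewrite mulrDr mulrDl -Ec -Ec' /corners_sum -big_split.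
    by apply: eq_bigr => i _; apply: (raddfD (Rphi i)).
  exists (fun i => pure r (lam i y) : RB i).
  rewrite !pureM mul1r mulr1 mulr_suml big_distrlr pure_sum; apply: eq_bigr => i _.
  rewrite Rphi_pure lamK; congr (pure _ _).
  rewrite (bigD1 i) //= big1 ?addr0 // => j ji.
  by rewrite phi_orth // eq_sym.
have [J [k [p p1]]] := phi_full.
(* The extra factor e_(k j) on the left selects one summand of e. *)
exists [seq (pure 1 ((p j).1 * phi (k j) 1) : RY, pure 1 (p j).2 : RY) | j <- enum J].
rewrite big_map big_enum corners_sum1 /=.
transitivity (pure 1 (1 : Y) : RY); last by [].
rewrite -p1 [RHS]pure_sum; apply: eq_bigr => j _; rewrite !pureM !mulr1.
congr (pure _ (_ * _)); rewrite mulr_sumr (bigD1 (k j)) //= big1 ?addr0 => [|i ik].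
  by rewrite -mulrA -phiM mulr1.
by rewrite -mulrA phi_orth2 ?mulr0 // eq_sym.
Qed.

End OrthogonalCorners.

(** * Scalars *)

(** X^n - 1 splits and is separable in characteristic 0, and n distinct n-th roots of unity in a
    field form a cyclic group. *)
Lemma closed_prim_root_exists (F : numClosedFieldType) n :
  (0 < n)%N -> exists z : F, n.-primitive_root z.
Proof.
move=> n_gt0; have [r] := closed_field_poly_normal ('X^n - 1 : {poly F}).
rewrite (monicP (monicXnsubC _ n_gt0)) scale1r => Er.
suff /hasP[z _ zP] : has n.-primitive_root r by exists z.
apply: has_prim_root => //.
- by apply/allP => z; rewrite -root_prod_XsubC -Er.
- rewrite -separable_prod_XsubC -Er separable_Xn_sub_1 //.
  by rewrite Num.Theory.pnatr_eq0 -lt0n.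
- by rewrite -ltnS -(size_prod_XsubC r id) -Er size_XnsubC.
Qed.

(** Orthogonality of the characters of Z/d, with the exponent d - s standing for -s: a geometric sum
    in w = zeta^(a - b). It makes e_i and the projections below act on weight vectors by 0 or 1. *)
Lemma sum_prim_root_exp (F : numFieldType) d (zeta : F) (a b : 'I_d) :
  d.-primitive_root zeta ->
  d%:R^-1 * \sum_(0 <= s < d) (zeta ^+ a) ^+ s * (zeta ^+ b) ^+ (d - s) = (a == b)%:R.
Proof.
move=> zetaP; have d_gt0 := prim_order_gt0 zetaP.
have zeta0 : zeta != 0.
  apply: contra_eq_neq (prim_expr_order zetaP) => ->.
  by rewrite expr0n eqn0Ngt d_gt0 eq_sym oner_neq0.
pose w := zeta ^+ a / zeta ^+ b.
have wd : w ^+ d = 1.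
  by rewrite exprMn exprVn -!exprM -!(mulnC d) !exprM (prim_expr_order zetaP) !expr1n divr1.
rewrite big_mkord (eq_bigr (fun s : 'I_d => w ^+ s)); last first.
  move=> s _; rewrite exprMn exprVn; congr (_ * _).
  rewrite expfB // -exprM mulnC exprM (prim_expr_order zetaP) expr1n mul1r //.
have [ab|ab] := eqVneq a b.
  rewrite (eq_bigr (fun=> 1)) => [|s _]; last first.
    by rewrite /w ab divff ?expr1n // expf_neq0.
  by rewrite sumr_const card_ord mulVf // Num.Theory.pnatr_eq0 -lt0n.
have /eqP := subrX1 w d; rewrite wd subrr eq_sym mulf_eq0 => /orP[|/eqP->]; last first.
  by rewrite mulr0.
rewrite subr_eq0 => /eqP w1; case/eqP: ab; apply: val_inj => /=.
have /eqP : zeta ^+ a = zeta ^+ b by rewrite -[LHS](divfK (expf_neq0 b zeta0)) -/w w1 mul1r.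
by rewrite (eq_prim_root_expr zetaP) !modn_small // => /eqP.
Qed.

Section CuvScalars.
Variable K : realType.

Lemma Cuv_const_zmod : zmod_morphism (@Cuv_const K).
Proof. by move=> x y; apply: val_inj; rewrite /= !rmorphB. Qed.
Lemma Cuv_const_monoid : monoid_morphism (@Cuv_const K).
Proof.
split=> [|x y]; apply: val_inj; rewrite [LHS]SubK.
  by rewrite [RHS](rmorph1 (\val : Cuv K -> _)) !polyC1 tofrac1.
rewrite [RHS](rmorphM (\val : Cuv K -> _)) ![X in _ = X * _]SubK ![X in _ = _ * X]SubK.
by rewrite !polyCM tofracM.
Qed.
HB.instance Definition _ :=
  GRing.isZmodMorphism.Build K[i] (Cuv K) (@Cuv_const K) Cuv_const_zmod.
HB.instance Definition _ :=
  GRing.isMonoidMorphism.Build K[i] (Cuv K) (@Cuv_const K) Cuv_const_monoid.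

Lemma Cuv_u_inv : {w : Cuv K | w * Cuv_u K = 1}.
Proof.
have uV : @is_Cuv K (tofrac 'X)^-1.
  by apply/asboolP; exists 1, 1%N; rewrite expr1 tofrac1 mul1r.
exists (Sub _ uV : Cuv K); apply: val_inj.
rewrite [LHS](rmorphM (\val : Cuv K -> _)) ![X in X * _]SubK ![X in _ * X]SubK.
rewrite [RHS](rmorph1 (\val : Cuv K -> _)) mulVf //.
by rewrite -[X in X != 0]expr1 tofracX_neq0.
Qed.

End CuvScalars.

(** * Weight vectors *)

Section Transpositions.
Variables (n d : nat).
Local Notation X := {ffun 'I_n -> 'I_d}.
Implicit Types (chi : X) (i : 'I_n.-1).

Definition sw i : 'I_n -> 'I_n := tperm (ord_lo i) (ord_hi i).
Definition swX i chi : X := [ffun j => chi (sw i j)].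

Lemma swK i : involutive (sw i). Proof. exact: tpermK. Qed.
Lemma swXK i : involutive (swX i).
Proof. by move=> chi; apply/ffunP => j; rewrite !ffunE swK. Qed.
Lemma swX_lo chi i : swX i chi (ord_lo i) = chi (ord_hi i).
Proof. by rewrite ffunE /sw tpermL. Qed.
Lemma swX_hi chi i : swX i chi (ord_hi i) = chi (ord_lo i).
Proof. by rewrite ffunE /sw tpermR. Qed.

End Transpositions.

Section Weights.
Variables (F : numFieldType) (A : comPzRingType) (kap : {rmorphism F -> A}).
Variables (n d : nat) (zeta : F) (u v : A) (Y : algebra A).
Variables (g : 'I_n.-1 -> Y) (t : 'I_n -> Y).
Hypothesis zetaP : d.-primitive_root zeta.
Local Notation sc := (alg_scalar Y).
Local Notation X := {ffun 'I_n -> 'I_d}.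
Local Notation char c := (kap (zeta ^+ nat_of_ord c)).

Definition yok_idem (i : 'I_n.-1) : Y := sc (kap d%:R^-1) *
  \sum_(0 <= s < d) t (ord_lo i) ^+ s * t (ord_hi i) ^+ (d - s).

Record yok_relations : Prop := YokRelations {
  yok_g_far : forall i j, far i j -> g i * g j = g j * g i;
  yok_g_braid : forall i j : 'I_n.-1, j = i.+1 :> nat ->
    g i * g j * g i = g j * g i * g j;
  yok_tC : forall i j, t i * t j = t j * t i;
  yok_g_t : forall i j, g i * t j = t (sw i j) * g i;
  yok_t_d : forall j, t j ^+ d = 1;
  yok_g_sq : forall i, g i * g i = sc (u ^+ 2) + sc v * yok_idem i * g i }.
Hypothesis yokP : yok_relations.

Let t_g i j : t j * g i = g i * t (sw i j).
Proof. by rewrite (yok_g_t yokP) swK. Qed.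

Let yscC a y : sc a * y = y * sc a. Proof. exact: alg_scalarC. Qed.

Section Module.
Variable M : lmodType Y.
Implicit Types (chi : X) (z : M).

Lemma yscZC a y z : sc a *: (y *: z) = y *: (sc a *: z).
Proof. by rewrite !scalerA yscC. Qed.

(** Weight vectors are taken in an arbitrary Y-module, so that the same lemmas serve Y acting on
    itself and the module of Hecke-valued functions. *)
Definition wt chi z := forall j, t j *: z = sc (char (chi j)) *: z.

Lemma wtD chi z z' : wt chi z -> wt chi z' -> wt chi (z + z').
Proof. by move=> wz wz' j; rewrite !scalerDr wz wz'. Qed.
Lemma wtZ chi a z : wt chi z -> wt chi (sc a *: z).
Proof. by move=> wz j; rewrite -yscZC wz yscZC. Qed.
Lemma wt_g chi i z : wt chi z -> wt (swX i chi) (g i *: z).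
Proof. by move=> wz j; rewrite scalerA t_g -scalerA wz ffunE yscZC. Qed.

Lemma wt_tX chi z j k : wt chi z -> t j ^+ k *: z = sc (char (chi j) ^+ k) *: z.
Proof.
move=> wz; elim: k => [|k IH]; first by rewrite !expr0 rmorph1.
by rewrite exprS -scalerA IH -yscZC wz scalerA -rmorphM -exprSr.
Qed.

Lemma wt_e chi i z : wt chi z ->
  yok_idem i *: z = if chi (ord_lo i) == chi (ord_hi i) then z else 0.
Proof.
move=> wz; rewrite /yok_idem -scalerA scaler_suml.
under eq_bigr do rewrite -scalerA (wt_tX _ _ wz) -yscZC (wt_tX _ _ wz) scalerA -rmorphM.
rewrite -scaler_suml scalerA -rmorph_sum -rmorphM.
under eq_bigr do rewrite mulrC -!rmorphXn -rmorphM.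
rewrite -rmorph_sum -rmorphM sum_prim_root_exp //.
by case: eqP => _; rewrite ?rmorph1 ?rmorph0 ?scale1r ?scale0r.
Qed.

Lemma wt_gg chi i z : wt chi z -> g i *: (g i *: z) =
  sc (u ^+ 2) *: z + (if chi (ord_lo i) == chi (ord_hi i) then sc v *: (g i *: z) else 0).
Proof.
move=> wz; rewrite scalerA (yok_g_sq yokP) scalerDl -[(_ * g i) *: z]scalerA.
rewrite -[(_ * yok_idem i) *: _]scalerA (wt_e _ (wt_g _ wz)) swX_lo swX_hi.
by rewrite eq_sym; case: eqP => // _; rewrite !scaler0.
Qed.

End Module.

(** Discrete Fourier projection onto the eigenvalue zeta^c of [t j]; [char c ^+ (d - s)] is
    zeta^(-cs). *)
Definition proj (j : 'I_n) (c : 'I_d) : Y := sc (kap d%:R^-1) *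
  \sum_(0 <= s < d) sc (char c ^+ (d - s)) * t j ^+ s.

Lemma wt_proj (M : lmodType Y) chi j c (z : M) : wt chi z ->
  proj j c *: z = if chi j == c then z else 0.
Proof.
move=> wz; rewrite /proj -scalerA scaler_suml.
under eq_bigr do rewrite -scalerA (wt_tX _ _ wz) scalerA -rmorphM.
rewrite -scaler_suml scalerA -rmorph_sum -rmorphM.
under eq_bigr do rewrite mulrC -!rmorphXn -rmorphM.
rewrite -rmorph_sum -rmorphM sum_prim_root_exp //.
by case: eqP => _; rewrite ?rmorph1 ?rmorph0 ?scale1r ?scale0r.
Qed.

Lemma t_projC i j c : t i * proj j c = proj j c * t i.
Proof.
rewrite /proj mulrA -yscC -!mulrA; congr (_ * _).
rewrite mulr_sumr mulr_suml; apply: eq_bigr => s _.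
rewrite mulrA -yscC -!mulrA; congr (_ * _).
by apply: commrX; apply: (yok_tC yokP).
Qed.

Lemma t_proj j c : t j * proj j c = sc (char c) * proj j c.
Proof.
rewrite /proj [LHS]mulrA -yscC [RHS]mulrA [sc (char c) * _]yscC -!mulrA; congr (_ * _).
have cd : char c ^+ d = 1 :> A.
  by rewrite -rmorphXn -exprM mulnC exprM (prim_expr_order zetaP) expr1n rmorph1.
have d_gt0 := prim_order_gt0 zetaP.
have recl m (f : nat -> Y) : (0 < m)%N ->
    \sum_(0 <= s < m) f s = f 0%N + \sum_(0 <= s < m.-1) f s.+1.
  by case: m => // m _; rewrite big_nat_recl.
have recr m (f : nat -> Y) : (0 < m)%N ->
    \sum_(0 <= s < m) f s = f m.-1 + \sum_(0 <= s < m.-1) f s.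
  by case: m => // m _; rewrite big_nat_recr //= addrC.
(* Multiplication by [t j] shifts the index cyclically: since [t j ^+ d = 1], the last term on the
   left is the term s = 0 on the right. *)
rewrite !mulr_sumr recr // [RHS]recl //; congr (_ + _).
  rewrite subn0 expr0 cd rmorph1 !mulr1 -subn1 subKn // expr1.
  by rewrite mulrA -yscC -mulrA -exprS subn1 prednK // (yok_t_d yokP) mulr1.
apply: eq_big_nat => s /andP[_ sd].
rewrite [LHS]mulrA -yscC -mulrA -exprS [RHS]mulrA -rmorphM -exprS subnSK //.
by rewrite (leq_trans sd) ?leq_pred.
Qed.

(** After exchanging the sums, the coefficient of [t j ^+ s] is the mean of all zeta^(-cs), which is
    1 for s = 0 and 0 for 0 < s < d. *)
Lemma sum_proj j : \sum_c proj j c = 1.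
Proof.
rewrite /proj -mulr_sumr exchange_big /=.
under eq_bigr do rewrite -mulr_suml -rmorph_sum.
have d_gt0 := prim_order_gt0 zetaP.
rewrite big_ltn // big_nat_cond [X in _ + X]big1 => [|s /andP[/andP[s_gt0 sd] _]].
  rewrite addr0 expr0 mulr1 subn0 -rmorphM.
  rewrite (eq_bigr (fun=> 1)) => [|c _]; last first.
    by rewrite -rmorphXn -exprM mulnC exprM (prim_expr_order zetaP) expr1n rmorph1.
  rewrite sumr_const card_ord -(rmorph_nat kap) -rmorphM mulVf ?rmorph1 //.
  by rewrite Num.Theory.pnatr_eq0 -lt0n.
suff -> : \sum_(c < d) char c ^+ (d - s) = 0 :> A by rewrite rmorph0 mul0r.
under eq_bigr do rewrite -rmorphXn -exprM mulnC exprM.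
rewrite -rmorph_sum; set w := zeta ^+ (d - s).
have /eqP := subrX1 w d.
rewrite /w -exprM mulnC exprM (prim_expr_order zetaP) expr1n subrr eq_sym mulf_eq0.
rewrite subr_eq0 -(prim_order_dvd zetaP) => /orP[/dvdn_leq|/eqP-> //]; last by rewrite rmorph0.
by rewrite subn_gt0 sd leqNgt ltn_subrL s_gt0 d_gt0 => /(_ isT).
Qed.

Definition idem (chi : X) : Y := \prod_j proj j (chi j).

Lemma wt_idem chi : wt chi (idem chi : Y^o).
Proof.
move=> j; rewrite /idem.
have : j \in index_enum 'I_n by rewrite mem_index_enum.
elim: (index_enum _) => // i r IH; rewrite inE big_cons.
have [<- _|_ /= /IH{}IH] := eqVneq j i.
  by rewrite [LHS]mulrA t_proj -mulrA.
rewrite [LHS]mulrA t_projC -mulrA [X in _ * X]IH.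
by rewrite [LHS]mulrA -yscC -mulrA.
Qed.

Lemma idem_wt (M : lmodType Y) chi chi' (z : M) : wt chi z ->
  idem chi' *: z = if chi' == chi then z else 0.
Proof.
move=> wz; rewrite /idem.
have -> : (chi' == chi) = all (fun j => chi' j == chi j) (index_enum 'I_n).
  apply/eqP/allP => [-> //|e]; apply/ffunP => j; apply/eqP/e.
  by rewrite mem_index_enum.
elim: (index_enum _) => [|j r IH]; first by rewrite big_nil scale1r.
rewrite big_cons -scalerA IH /=; case: all; last by rewrite scaler0 andbF.
by rewrite andbT (wt_proj _ _ wz) eq_sym.
Qed.

Lemma sum_idem : \sum_chi idem chi = 1.
Proof.
rewrite /idem -(bigA_distr_bigA (fun j c => proj j c)) big1 // => j _.
exact: sum_proj.
Qed.

(** Since the idempotents sum to 1, identities in Y can be tested on weight vectors, where every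
    correction term is a scalar. All relations for [psi_gen] are proved this way. *)
Lemma wt_ext (y y' : Y) :
  (forall chi (z : Y^o), wt chi z -> y * z = y' * z) -> y = y'.
Proof.
move=> yy'; rewrite -[y]mulr1 -[y']mulr1 -sum_idem !mulr_sumr.
by apply: eq_bigr => chi _; apply/yy'/wt_idem.
Qed.

End Weights.

(** * Words with given content *)

Section Words.
Variables (n d : nat).
Local Notation X := {ffun 'I_n -> 'I_d}.
Implicit Types (chi : X) (i j : 'I_n.-1).

Definition desc i chi : bool := (chi (ord_hi i) < chi (ord_lo i))%N.
Definition flat i chi : bool := chi (ord_lo i) == chi (ord_hi i).
Definition sorted_word chi : bool := [forall i, ~~ desc i chi].

Definition braid_adj i j : Prop := j = i.+1 :> nat \/ i = j.+1 :> nat.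

Lemma far_or_adj i j : [\/ i = j, far i j | braid_adj i j].
Proof.
rewrite /far /braid_adj; have [ij|] := eqVneq i j; first by constructor 1.
rewrite -val_eqE /= => ij; case: (boolP (_ || _)) => [_|nfar]; first by constructor 2.
by constructor 3; lia.
Qed.

Lemma farC i j : far i j = far j i. Proof. exact: orbC. Qed.

Lemma sw_id i (l : 'I_n) : l != i :> nat -> l != i.+1 :> nat -> sw i l = l.
Proof. by move=> li li1; rewrite /sw tpermD // -val_eqE eq_sym. Qed.

Lemma swX_far i j chi : far i j ->
  swX i chi (ord_lo j) = chi (ord_lo j) /\ swX i chi (ord_hi j) = chi (ord_hi j).
Proof. by rewrite /far => ij; split; rewrite ffunE sw_id //=; lia. Qed.

Lemma desc_far i j chi : far i j -> desc j (swX i chi) = desc j chi.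
Proof. by move=> /(swX_far chi)[e1 e2]; rewrite /desc e1 e2. Qed.
Lemma flat_far i j chi : far i j -> flat j (swX i chi) = flat j chi.
Proof. by move=> /(swX_far chi)[e1 e2]; rewrite /flat e1 e2. Qed.

Lemma swXC i j chi : far i j -> swX i (swX j chi) = swX j (swX i chi).
Proof.
move=> ij; apply/ffunP => l; rewrite !ffunE; congr (chi _).
have lo (k : 'I_n.-1) : sw k (ord_lo k) = ord_hi k by rewrite /sw tpermL.
have hi (k : 'I_n.-1) : sw k (ord_hi k) = ord_lo k by rewrite /sw tpermR.
rewrite /far in ij.
have [l1|l1] := eqVneq (l : nat) i.
  by rewrite (_ : l = ord_lo i) ?lo ?[sw j _]sw_id ?lo //=; try lia; apply: val_inj.
have [l2|l2] := eqVneq (l : nat) i.+1.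
  by rewrite (_ : l = ord_hi i) ?hi ?[sw j _]sw_id ?hi //=; try lia; apply: val_inj.
rewrite (sw_id l1 l2).
have [l3|l3] := eqVneq (l : nat) j.
  by rewrite (_ : l = ord_lo j) ?lo ?[sw i _]sw_id //=; try lia; apply: val_inj.
have [l4|l4] := eqVneq (l : nat) j.+1.
  by rewrite (_ : l = ord_hi j) ?hi ?[sw i _]sw_id //=; try lia; apply: val_inj.
by rewrite !(sw_id l3 l4) sw_id.
Qed.

Section Adjacent.
Variables (i j : 'I_n.-1) (ij : j = i.+1 :> nat).
Variable chi : X.

Lemma ord_hi_lo : ord_hi i = ord_lo j. Proof. by apply: val_inj; rewrite /= ij. Qed.
Let swi_hj : sw i (ord_hi j) = ord_hi j.
Proof. by rewrite sw_id //= ij; lia. Qed.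
Let swj_li : sw j (ord_lo i) = ord_lo i.
Proof. by rewrite sw_id //= ij; lia. Qed.

Lemma swX_adj : [/\ swX i chi (ord_hi j) = chi (ord_hi j),
  swX i chi (ord_lo j) = chi (ord_lo i), swX j chi (ord_lo i) = chi (ord_lo i)
  & swX j chi (ord_hi i) = chi (ord_hi j)].
Proof.
by split; rewrite ffunE ?swi_hj ?swj_li // ?ord_hi_lo -?ord_hi_lo /sw ?tpermR // ord_hi_lo tpermL.
Qed.

Lemma swX_braid : swX i (swX j (swX i chi)) = swX j (swX i (swX j chi)).
Proof.
have lo (k : 'I_n.-1) : sw k (ord_lo k) = ord_hi k by rewrite /sw tpermL.
have hi (k : 'I_n.-1) : sw k (ord_hi k) = ord_lo k by rewrite /sw tpermR.
apply/ffunP => l; rewrite !ffunE; congr (chi _).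
have [l1|l1] := eqVneq (l : nat) i.
  rewrite (_ : l = ord_lo i); last exact: val_inj.
  by rewrite swj_li lo ord_hi_lo lo swi_hj.
have [l2|l2] := eqVneq (l : nat) i.+1.
  rewrite (_ : l = ord_hi i); last exact: val_inj.
  by rewrite hi swj_li lo ord_hi_lo lo swi_hj hi.
have [l3|l3] := eqVneq (l : nat) j.+1.
  rewrite (_ : l = ord_hi j); last exact: val_inj.
  by rewrite swi_hj hi -ord_hi_lo hi swj_li.
have sjl : sw j l = l by apply: sw_id; rewrite // ij.
by rewrite !(sw_id l1 l2, sjl).
Qed.

End Adjacent.

(** For j = i + 1, the first case concerns letters a a b with b < a: moving b to the front carries
    the equal pair from i to j. The second concerns c b a with c > b > a, which can be reversed
    starting from either descent. For i = j + 1 the picture is mirrored. *)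
Lemma adj_values i j chi : braid_adj i j ->
  (flat i chi -> desc j chi -> desc i (swX j chi) /\ flat j (swX i (swX j chi))) /\
  (desc i chi -> desc j chi -> desc i (swX j chi) /\ desc j (swX i (swX j chi))).
Proof.
rewrite /flat /desc; case=> ij.
  have [e1 e2 e3 e4] := swX_adj ij chi; have [f1 f2 f3 f4] := swX_adj ij (swX j chi).
  rewrite e3 e4 f1 f2 e3 swX_hi -(ord_hi_lo ij).
  by split=> [/eqP->|? ?]; split=> //; apply: ltn_trans; eassumption.
have [e1 e2 e3 e4] := swX_adj ij chi; have [f1 f2 f3 f4] := swX_adj ij (swX j chi).
rewrite e1 e2 f3 f4 e1 swX_lo (ord_hi_lo ij).
by split=> [/eqP->|? ?]; split=> //; apply: ltn_trans; eassumption.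
Qed.

Lemma swX_braid_adj i j chi : braid_adj i j ->
  swX i (swX j (swX i chi)) = swX j (swX i (swX j chi)).
Proof. by case=> ij; [|symmetry]; apply: swX_braid. Qed.

Lemma flat_swX i chi : flat i chi -> swX i chi = chi.
Proof.
move=> /eqP e; apply/ffunP => l; rewrite ffunE /sw.
by case: tpermP => // ->; rewrite e.
Qed.

(** Termination measure for sorting: positions weigh less towards the right, so swapping a descent
    lowers the sum by the difference of its letters. *)
Definition word_meas chi : nat := (\sum_(l < n) (n - l) * chi l)%N.

Lemma desc_meas i chi : desc i chi -> (word_meas (swX i chi) < word_meas chi)%N.
Proof.
rewrite /desc => di; rewrite /word_meas.
have lohi : ord_hi i != ord_lo i by rewrite -val_eqE /= eqn_leq ltnn.
have split2 (F : 'I_n -> nat) : (\sum_l F l = F (ord_lo i) +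
    (F (ord_hi i) + \sum_(l | (l != ord_lo i) && (l != ord_hi i)) F l))%N.
  by rewrite (bigD1 (ord_lo i)) // (bigD1 (ord_hi i)).
rewrite !split2 swX_lo swX_hi.
rewrite (eq_bigr (fun l : 'I_n => (n - l) * chi l)%N) => [|l /andP[l1 l2]]; last first.
  by rewrite ffunE sw_id.
have i_lt := ord_hi_subproof i; rewrite /= -(subnSK (ltnW i_lt)) !mulSn.
move: di; move: (nat_of_ord (chi _)) (nat_of_ord (chi _)) (\sum_(_ < n | _) _)%N => b a S.
by move: (n - i.+1)%N => p; lia.
Qed.

Lemma word_ind (P : X -> Prop) :
  (forall chi, (forall chi', (word_meas chi' < word_meas chi)%N -> P chi') -> P chi) ->
  forall chi, P chi.
Proof.
move=> H chi; move: {2}(word_meas chi) (leqnn (word_meas chi)) => m.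
elim: m chi => [|m IH] chi chim; apply: H => chi' lt; first lia.
by apply: IH; lia.
Qed.

Definition count_word chi (c : 'I_d) : nat := #|[set l | chi l == c]|.

Lemma count_swX i chi c : count_word (swX i chi) c = count_word chi c.
Proof.
rewrite /count_word -[RHS](card_preimset _ (can_inj (@swK n i))).
by apply: eq_card => l; rewrite !inE ffunE.
Qed.

Definition same_content chi chi' := forall c, count_word chi c = count_word chi' c.

(** An initial segment is determined by its size. This turns counts of letters into positions. *)
Lemma down_closed_ordP m (S : {set 'I_m}) :
  (forall a b : 'I_m, (a <= b)%N -> b \in S -> a \in S) ->
  forall a : 'I_m, (a \in S) = (a < #|S|)%N.
Proof.
have cardlt p : (p <= m)%N -> #|[set b : 'I_m | (b < p)%N]| = p.
  move=> pm; rewrite -[RHS](card_ord p) -!sum1_card.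
  rewrite (big_ord_widen m (fun=> 1%N) pm); apply: eq_bigl => b.
  by rewrite inE.
move=> Sd a; apply/idP/idP => [aS|].
  rewrite -[X in (X <= _)%N](cardlt a.+1) //; apply: subset_leq_card.
  by apply/subsetP => b; rewrite inE ltnS => /Sd; apply.
apply: contraLR => aS; rewrite -leqNgt; rewrite -[X in (_ <= X)%N](cardlt _ (ltnW (ltn_ord a))).
apply: subset_leq_card; apply/subsetP => b bS; rewrite inE ltnNge.
by apply: contra aS => ab; apply: Sd bS.
Qed.

Lemma sorted_monotone chi : sorted_word chi ->
  forall l l' : 'I_n, (l <= l')%N -> (chi l <= chi l')%N.
Proof.
move=> /forallP so l [m mn] /=; elim: m mn => [|m IH] mn.
  rewrite leqn0 => /eqP l0; apply: eq_leq; congr (nat_of_ord (chi _)).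
  exact: val_inj.
rewrite leq_eqVlt => /predU1P[lm|lm]; first by rewrite (_ : l = Ordinal mn) //; apply: val_inj.
have mn' : (m < n.-1)%N by rewrite ltn_predRL.
apply: leq_trans (IH (ltnW mn) lm) _.
have := so (Ordinal mn'); rewrite /desc -leqNgt.
have -> : ord_lo (Ordinal mn') = Ordinal (ltnW mn) by apply: val_inj.
by have -> : ord_hi (Ordinal mn') = Ordinal mn by apply: val_inj.
Qed.

Lemma card_lt_count chi (c : nat) :
  #|[set l | (chi l < c)%N]| = (\sum_(c' < d | c' < c) count_word chi c')%N.
Proof.
rewrite -sum1_card (partition_big chi (fun c' : 'I_d => (c' < c)%N)) => [|l]; last by rewrite inE.
apply: eq_bigr => c' c'c; rewrite /count_word -sum1_card; apply: eq_bigl => l.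
by rewrite !inE andb_idl // => /eqP->.
Qed.

(** In a sorted word the positions of letters below c form an initial segment, and its length
    depends only on the content. *)
Lemma sorted_content_uniq chi chi' :
  sorted_word chi -> sorted_word chi' -> same_content chi chi' -> chi = chi'.
Proof.
move=> so so' e; have lt_iff psi (sop : sorted_word psi) (l : 'I_n) c :
    (psi l < c)%N = (l < \sum_(c' < d | c' < c) count_word psi c')%N.
  rewrite -card_lt_count -down_closed_ordP ?inE // => a b ab; rewrite !inE.
  exact/leq_ltn_trans/sorted_monotone.
apply/ffunP => l; apply: val_inj.
have key c : (chi l < c)%N = (chi' l < c)%N.
  by rewrite !lt_iff //; congr (_ < _)%N; apply: eq_bigr => c' _; apply: e.
case: (ltngtP (chi l) (chi' l)) => // lt; first by rewrite key ltnn in lt.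
by rewrite -key ltnn in lt.
Qed.

(** * The sorted word of a composition *)

Section OfComposition.
Variable mu : Comp d n.

(* The sorted word mu_1 times 0, mu_2 times 1, ... *)
Definition comp_word_val (l : nat) : nat := #|[set c : 'I_d | (comp_psum mu c.+1 <= l)%N]|.

Lemma comp_psum_le k k' : (k <= k')%N -> (comp_psum mu k <= comp_psum mu k')%N.
Proof.
move=> kk'; rewrite /comp_psum big_mkcond [X in (_ <= X)%N]big_mkcond /=.
by apply: leq_sum => c _; case: ltnP => // ck; rewrite (leq_trans ck).
Qed.

Lemma comp_psumd : comp_psum mu d = n.
Proof.
rewrite -[RHS](eqP (valP mu)) /comp_psum; apply: eq_bigl => c.
by rewrite ltn_ord.
Qed.

Lemma comp_psumS (c : 'I_d) : comp_psum mu c.+1 = (comp_psum mu c + val mu c)%N.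
Proof.
rewrite /comp_psum (bigD1 c) //= addnC; congr (_ + _)%N; apply: eq_bigl => c'.
by rewrite ltnS ltn_neqAle andbC.
Qed.

Lemma comp_word_valP (c : 'I_d) l : (c < comp_word_val l)%N = (comp_psum mu c.+1 <= l)%N.
Proof.
rewrite /comp_word_val -down_closed_ordP ?inE // => a b ab; rewrite !inE.
by move=> bl; apply: leq_trans bl; exact: (@comp_psum_le a.+1 b.+1 ab).
Qed.

Lemma comp_word_val_lt (l : 'I_n) : (comp_word_val l < d)%N.
Proof.
have d_gt0 : (0 < d)%N.
  case: (posnP d) => // d0; have := comp_psumd; rewrite /comp_psum big1 => [n0|c _].
    by move: (leq_trans (ltn_ord l) (eq_leq (esym n0))).
  by move: (leq_trans (ltn_ord c) (eq_leq d0)).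
have pd : (d.-1 < d)%N by rewrite prednK.
have := comp_word_valP (Ordinal pd) l.
by rewrite /= prednK // comp_psumd [in RHS]leqNgt ltn_ord /=; lia.
Qed.

Definition comp_word : X := [ffun l => Ordinal (comp_word_val_lt l)].

Lemma comp_wordP (c : 'I_d) l : (c < comp_word l)%N = (comp_psum mu c.+1 <= l)%N.
Proof. by rewrite ffunE; apply: comp_word_valP. Qed.

Lemma comp_word_sorted : sorted_word comp_word.
Proof.
apply/forallP => i; rewrite /desc -leqNgt leqNgt; apply/negP => lt.
have := comp_wordP (comp_word (ord_hi i)) (ord_lo i).
rewrite lt => /esym/leq_trans/(_ (leqnSn _)).
by rewrite -[i.+1]/(nat_of_ord (ord_hi i)) -comp_wordP ltnn.
Qed.

Lemma comp_word_count c : count_word comp_word c = val mu c.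
Proof.
have cardS k : (k <= d)%N -> #|[set l | (comp_word l < k)%N]| = comp_psum mu k.
  case: k => [_|k kd].
    rewrite /comp_psum big1 => [|c' //]; apply/eqP; rewrite cards_eq0.
    by apply/eqP/setP => l; rewrite !inE.
  have pn : (comp_psum mu k.+1 <= n)%N by apply: leq_trans (eq_leq comp_psumd); apply: comp_psum_le.
  rewrite -[RHS](card_ord (comp_psum mu k.+1)) -!sum1_card.
  rewrite (big_ord_widen n (fun=> 1%N) pn); apply: eq_bigl => l.
  by rewrite inE ltnS leqNgt (comp_wordP (Ordinal kd)) -ltnNge.
have := cardS c.+1 (ltn_ord c).
rewrite comp_psumS -(cardS _ (ltnW (ltn_ord c))) !card_lt_count (bigD1 c) //= addnC.
rewrite (eq_bigl (fun c' : 'I_d => (c' < c)%N)) => [/addnI //|c'].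
by rewrite ltnS ltn_neqAle andbC.
Qed.

(** Translates the generators of [hecke_parabolic], given by partial sums, into positions where the
    sorted word has equal letters. *)
Lemma comp_word_flat i :
  flat i comp_word <-> forall k, (0 < k < d)%N -> i.+1 <> comp_psum mu k.
Proof.
split=> [/eqP e [//|k] /andP[_ kd] ik|H].
  have := comp_wordP (Ordinal (ltnW kd)) (ord_hi i); rewrite -e comp_wordP /= -ik.
  by rewrite leqnn ltnn.
apply/negPn/negP => ne.
have lt : (comp_word (ord_lo i) < comp_word (ord_hi i))%N.
  rewrite ltn_neqAle ne leqNgt /=.
  exact: (forallP comp_word_sorted i).
(* The boundary is indexed by one more than the letter before the jump; this index is below d
   because the next letter is larger. *)
case: (H (comp_word (ord_lo i)).+1); first by rewrite (leq_ltn_trans lt).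
apply/eqP; rewrite eqn_leq; have := comp_wordP (comp_word (ord_lo i)) (ord_hi i).
rewrite lt => <-; rewrite andbT ltnNge.
by have := comp_wordP (comp_word (ord_lo i)) (ord_lo i); rewrite ltnn => <-.
Qed.

End OfComposition.

(** A letter occurs at most n times, so [inord] never falls back on its default. *)
Definition count_ffun chi : {ffun 'I_d -> 'I_n.+1} := [ffun c => inord (count_word chi c)].
Lemma content_subproof chi : (\sum_(c < d) count_ffun chi c == n)%N.
Proof.
rewrite (eq_bigr (fun c => count_word chi c)) => [|c _]; last first.
  by rewrite ffunE inordK // ltnS -[X in (_ <= X)%N]card_ord max_card.
apply/eqP; transitivity #|[set l | (chi l < d)%N]|.
  by rewrite card_lt_count; apply: eq_bigl => c; rewrite ltn_ord.
by rewrite -[RHS](card_ord n); apply: eq_card => l; rewrite inE ltn_ord.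
Qed.
Definition content chi : Comp d n :=
  exist (fun mu : {ffun 'I_d -> 'I_n.+1} => \sum_(j < d) mu j == n)%N _ (content_subproof chi).

Lemma contentE chi c : val (content chi) c = count_word chi c :> nat.
Proof. by rewrite /= ffunE inordK // ltnS -[X in (_ <= X)%N]card_ord max_card. Qed.

Lemma comp_word_content chi : same_content chi (comp_word (content chi)).
Proof. by move=> c; rewrite comp_word_count contentE. Qed.

Lemma comp_word_same mu nu : same_content (comp_word mu) (comp_word nu) -> mu = nu.
Proof.
move=> e; apply/val_inj/ffunP => c; apply: val_inj.
exact: etrans (esym (comp_word_count mu c)) (etrans (e c) (comp_word_count nu c)).
Qed.

End Words.

(** * From the Hecke algebra to the Yokonuma-Hecke algebra *)

Section HeckeToYokonuma.
Variables (F : numFieldType) (A : comPzRingType) (kap : {rmorphism F -> A}).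
Variables (n d : nat) (zeta : F) (u v : A) (Y : algebra A).
Variables (g : 'I_n.-1 -> Y) (t : 'I_n -> Y).
Hypothesis zetaP : d.-primitive_root zeta.
Hypothesis yokP : yok_relations kap d u v g t.
Local Notation sc := (alg_scalar Y).
Local Notation X := {ffun 'I_n -> 'I_d}.
Local Notation wt := (wt kap zeta t).
Implicit Types (chi : X) (i j : 'I_n.-1).

Definition desc_proj i : Y :=
  \sum_(c < d) \sum_(c' < d | (c' < c)%N)
    proj kap zeta t (ord_lo i) c * proj kap zeta t (ord_hi i) c'.

Definition desc_coef i chi : A := if desc i chi then v else 0.
Definition flat_coef i chi : A := if flat i chi then v else 0.

(* On vectors of weight chi with chi_i <> chi_(i+1) one has [g_i^2 = u^2]; adding [v]
   for exactly one of the two orders of (chi_i, chi_(i+1)) restores the quadratic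
   relation of the Hecke algebra. *)
Definition psi_gen i : Y := g i + sc v * desc_proj i.

Section Module.
Variable M : lmodType Y.
Implicit Types z : M.

Lemma wt_desc_proj chi i z : wt chi z ->
  desc_proj i *: z = if desc i chi then z else 0.
Proof.
move=> wz; rewrite /desc_proj scaler_suml (bigD1 (chi (ord_lo i))) //= [X in _ + X]big1.
  rewrite addr0 scaler_suml /desc.
  under eq_bigr => c' _ do rewrite -scalerA (wt_proj zetaP _ _ wz).
  rewrite (eq_bigr (fun c' => if chi (ord_hi i) == c' then z else 0)) => [|c' _]; last first.
    by case: eqP; rewrite ?scaler0 // (wt_proj zetaP _ _ wz) eqxx.
  rewrite -big_mkcondr /= (eq_bigl (fun c' => (c' == chi (ord_hi i)) && (c' < chi (ord_lo i))%N)).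
    by rewrite big_mkcondr big_pred1_eq.
  by move=> c'; rewrite andbC eq_sym.
move=> c ne; rewrite scaler_suml big1 // => c' _; rewrite -scalerA (wt_proj zetaP _ _ wz).
case: eqP => _; rewrite ?scaler0 // (wt_proj zetaP _ _ wz).
by rewrite eq_sym (negbTE ne).
Qed.

Lemma wt_psi_gen chi i z : wt chi z -> psi_gen i *: z = g i *: z + sc (desc_coef i chi) *: z.
Proof.
move=> wz; rewrite scalerDl -[(sc v * _) *: _]scalerA (wt_desc_proj _ wz) /desc_coef.
by case: desc; rewrite ?rmorph0 ?scale0r ?scaler0.
Qed.

Lemma wt_gg_coef chi i z : wt chi z ->
  g i *: (g i *: z) = sc (u ^+ 2) *: z + sc (flat_coef i chi) *: (g i *: z).
Proof.
move=> wz; rewrite (wt_gg zetaP yokP _ wz) /flat_coef /flat.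
by case: eqP => _; rewrite ?rmorph0 ?scale0r.
Qed.

Lemma g_scZ i a z : g i *: (sc a *: z) = sc a *: (g i *: z). Proof. by rewrite yscZC. Qed.
Lemma psi_scZ i a z : psi_gen i *: (sc a *: z) = sc a *: (psi_gen i *: z).
Proof. by rewrite yscZC. Qed.

(** Normal form in products of the g's with scalar coefficients. The braid relation becomes a
    comparison of the coefficients for i j i and j i j, which depend only on the relative order of
    three letters. *)
Lemma wt_psi_triple chi i j z : wt chi z ->
  psi_gen i *: (psi_gen j *: (psi_gen i *: z)) =
  g i *: (g j *: (g i *: z)) +
  sc (desc_coef i (swX j (swX i chi))) *: (g j *: (g i *: z)) +
  sc (desc_coef i chi) *: (g i *: (g j *: z)) +
  sc (desc_coef j (swX i chi) * (flat_coef i chi + desc_coef i (swX i chi)) +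
      desc_coef i chi * desc_coef j chi) *: (g i *: z) +
  sc (desc_coef i chi * desc_coef i (swX j chi)) *: (g j *: z) +
  sc (desc_coef j (swX i chi) * u ^+ 2 + desc_coef i chi * desc_coef j chi * desc_coef i chi) *: z.
Proof.
move=> wz; have wi := wt_g yokP i wz; have wj := wt_g yokP j wz; have wji := wt_g yokP j wi.
rewrite (wt_psi_gen i wz) scalerDr psi_scZ (wt_psi_gen j wi) (wt_psi_gen j wz).
rewrite !(scalerDr, psi_scZ) (wt_psi_gen i wji) (wt_psi_gen i wi) (wt_psi_gen i wj).
rewrite (wt_psi_gen i wz) (wt_gg_coef i wz) !(scalerDr, g_scZ, scalerA) -!rmorphM.
rewrite -!scalerDl; congr (_ *: _).
rewrite !(rmorphD, rmorphM, mulrDr, mulrDl, mulrA, addrA).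
by rewrite [LHS](@GRing.add _).[ACl 1*2*6*4*5*8*7*3*9].
Qed.

End Module.

Let wt_ext := wt_ext zetaP yokP.

Lemma psi_gen_far i j : far i j -> psi_gen i * psi_gen j = psi_gen j * psi_gen i.
Proof.
move=> ij; apply: wt_ext => chi z wz; have ji : far j i by rewrite farC.
rewrite -!mulrA -!/(_ *: (_ *: z)) (wt_psi_gen j wz) (wt_psi_gen i wz) !scalerDr.
rewrite (wt_psi_gen i (wt_g yokP j wz)) (wt_psi_gen j (wt_g yokP i wz)).
rewrite /desc_coef !desc_far // -!/(desc_coef _ _).
rewrite !psi_scZ (wt_psi_gen j wz) (wt_psi_gen i wz) !scalerDr !scalerA (yok_g_far yokP ij).
rewrite -!rmorphM [_ * desc_coef i chi]mulrC -!addrA; congr (_ + _).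
by rewrite addrCA.
Qed.

Lemma psi_gen_braid (i j : 'I_n.-1) : j = i.+1 :> nat ->
  psi_gen i * psi_gen j * psi_gen i = psi_gen j * psi_gen i * psi_gen j.
Proof.
move=> ij; apply: wt_ext => chi z wz.
rewrite -!mulrA -!/(_ *: (_ *: (_ *: z))) (wt_psi_triple i j wz) (wt_psi_triple j i wz).
have -> : g i *: (g j *: (g i *: z)) = g j *: (g i *: (g j *: z)).
  by rewrite !scalerA (yok_g_braid yokP ij).
have [e1 e2 e3 e4] := swX_adj ij chi.
have [f1 f2 f3 f4] := swX_adj ij (swX i chi); have [h1 h2 h3 h4] := swX_adj ij (swX j chi).
rewrite /desc_coef /flat_coef /desc /flat e1 e2 e3 e4 f3 f4 e1 h1 h2 e3 -(ord_hi_lo ij).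
rewrite !swX_lo swX_hi (ord_hi_lo ij) swX_hi swX_lo -!val_eqE /=.
rewrite [RHS](@GRing.add _).[ACl 1*3*2*5*4*6].
move: (nat_of_ord (chi _)) (nat_of_ord (chi _)) (nat_of_ord (chi _)) => c b a.
have sc_congr x y (z' : Y^o) : x = y -> sc x *: z' = sc y *: z' by move=> ->.
(* Of the 27 triples of comparisons, the 13 weak orders on three letters are consistent; [lia]
   removes the others. *)
do 5?[congr (_ + _)]; apply: sc_congr;
  case: (ltngtP a b) => ab; case: (ltngtP b c) => bc; case: (ltngtP a c) => ac;
  try (clear -ab bc ac; exfalso; lia); by rewrite ?(mulr0, mul0r, addr0, add0r).
Qed.

Lemma psi_gen_sq i : psi_gen i * psi_gen i = sc (u ^+ 2) + sc v * psi_gen i.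
Proof.
apply: wt_ext => chi z wz.
transitivity (psi_gen i *: (psi_gen i *: z)); first exact: esym (mulrA _ _ _).
transitivity (sc (u ^+ 2) *: z + sc v *: (psi_gen i *: z)); last first.
  by rewrite [RHS]mulrDl -[X in _ = _ + X]mulrA.
rewrite (wt_psi_gen i wz) !scalerDr psi_scZ.
rewrite (wt_psi_gen i (wt_g yokP i wz)) (wt_psi_gen i wz) (wt_gg_coef i wz) -!addrA.
congr (_ + _); rewrite !scalerDr !scalerA -!scalerDl.
apply: (congr1 (fun y : Y => y *: z)); rewrite -!rmorphM.
transitivity (sc (flat_coef i chi + desc_coef i (swX i chi) + desc_coef i chi) * g i +
    sc (desc_coef i chi * desc_coef i chi)).
  by rewrite !rmorphD !mulrDl -!addrA.
(* Equality, ascent and descent exclude one another and exhaust the cases, so exactly one summand is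
   v. *)
have -> : flat_coef i chi + desc_coef i (swX i chi) + desc_coef i chi = v.
  rewrite /flat_coef /desc_coef /flat /desc swX_lo swX_hi -val_eqE /=.
  by case: ltngtP; rewrite ?(addr0, add0r).
by rewrite /desc_coef; case: desc; rewrite ?mulr0.
Qed.

End HeckeToYokonuma.

(** * A Yokonuma-Hecke module of functions with values in the Hecke algebra *)

Section HeckeFunctions.
Variables (F : numFieldType) (A : comPzRingType) (kap : {rmorphism F -> A}).
Variables (n d : nat) (zeta : F) (u v : A) (H : algebra A) (T : 'I_n.-1 -> H).
Hypothesis zetaP : d.-primitive_root zeta.
Local Notation sc := (alg_scalar H).
Local Notation X := {ffun 'I_n -> 'I_d}.
Local Notation char c := (kap (zeta ^+ nat_of_ord c)).
Implicit Types (chi : X) (i j : 'I_n.-1).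

Record hecke_relations : Prop := HeckeRelations {
  hecke_T_far : forall i j, far i j -> T i * T j = T j * T i;
  hecke_T_braid : forall i j, j = i.+1 :> nat -> T i * T j * T i = T j * T i * T j;
  hecke_T_sq : forall i, T i * T i = sc (u ^+ 2) + sc v * T i }.
Hypothesis heckeP : hecke_relations.

Definition hfun := {ffun X -> H}.
HB.instance Definition _ := GRing.Zmodule.on hfun.

Definition hfun_scale (a : A) (f : hfun) : hfun := [ffun chi => sc a * f chi].
Lemma hfun_scaleA a b f : hfun_scale a (hfun_scale b f) = hfun_scale (a * b) f.
Proof. by apply/ffunP => chi; rewrite !ffunE rmorphM mulrA. Qed.
Lemma hfun_scale1 : left_id 1 hfun_scale.
Proof. by move=> f; apply/ffunP => chi; rewrite !ffunE rmorph1 mul1r. Qed.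
Lemma hfun_scaleDr : right_distributive hfun_scale +%R.
Proof. by move=> a f f'; apply/ffunP => chi; rewrite !ffunE mulrDr. Qed.
Lemma hfun_scaleDl f : {morph hfun_scale^~ f : a b / a + b}.
Proof. by move=> a b; apply/ffunP => chi; rewrite !ffunE rmorphD mulrDl. Qed.
HB.instance Definition _ := GRing.Zmodule_isLmodule.Build A hfun
  hfun_scaleA hfun_scale1 hfun_scaleDr hfun_scaleDl.

Lemma hfunZ a (f : hfun) chi : (a *: f) chi = sc a * f chi.
Proof. exact: ffunE. Qed.

(** An ascent at the evaluation point chi is a descent of the source word [swX i chi], the place
    where [psi_gen] adds v. *)
Definition asc_coef i chi : A := if (chi (ord_lo i) < chi (ord_hi i))%N then v else 0.
Definition hfun_coef i chi : H := T i - sc (asc_coef i chi).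

(* At [chi] with [chi_i < chi_(i+1)] the operator multiplies by [u^2 T_i^-1]
   instead of [T_i]. *)
Definition hfun_g i (f : hfun) : hfun := [ffun chi => hfun_coef i chi * f (swX i chi)].
Definition hfun_t (j : 'I_n) (f : hfun) : hfun := [ffun chi : X => sc (char (chi j)) * f chi].

Lemma hfun_g_linear i : linear (hfun_g i).
Proof.
move=> a f f'; apply/ffunP => chi; rewrite !ffunE mulrDr; congr (_ + _).
by rewrite mulrA -alg_scalarC -mulrA.
Qed.
HB.instance Definition _ i := GRing.isLinear.Build A hfun hfun _ (hfun_g i) (hfun_g_linear i).
Lemma hfun_t_linear (j : 'I_n) : linear (hfun_t j).
Proof.
move=> a f f'; apply/ffunP => chi; rewrite !ffunE mulrDr; congr (_ + _).
by rewrite mulrA -alg_scalarC -mulrA.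
Qed.
HB.instance Definition _ (j : 'I_n) :=
  GRing.isLinear.Build A hfun hfun _ (hfun_t j) (hfun_t_linear j).

Lemma hfun_g_far i j f : far i j -> hfun_g i (hfun_g j f) = hfun_g j (hfun_g i f).
Proof.
move=> ij; have ji : far j i by rewrite farC.
apply/ffunP => chi; rewrite !ffunE /hfun_coef /asc_coef.
have [-> ->] := swX_far chi ij; have [-> ->] := swX_far chi ji.
rewrite swXC // !mulrA; congr (_ * _).
have cs (r : A) (x : H) : GRing.comm x (sc r) by apply/esym/alg_scalarC.
apply: commrB; last exact: cs.
by apply/commr_sym/commrB; [apply: (hecke_T_far heckeP)|apply: cs].
Qed.

(** Counterpart of [wt_psi_triple] inside H_n: the quadratic relation removes T_i T_i, and braid
    relations are again compared coefficientwise. *)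
Lemma hecke_triple i j (a b c : A) :
  (T i - sc a) * (T j - sc b) * (T i - sc c) =
  T i * T j * T i + sc (- a) * (T j * T i) + sc (- c) * (T i * T j) +
  sc (a * b + b * c - b * v) * T i + sc (a * c) * T j + sc (- (b * u ^+ 2 + a * b * c)).
Proof.
have -> : (T i - sc a) * (T j - sc b) = T i * T j - sc a * T j - sc b * T i + sc a * sc b.
  by rewrite mulrBl !mulrBr -(alg_scalarC b (T i)) opprB !addrA
    [LHS](@GRing.add _).[ACl 1*4*2*3].
rewrite mulrBr -(alg_scalarC c) !(mulrDl, mulNr) -!mulrA (hecke_T_sq heckeP).
rewrite !(rmorphD, rmorphN, rmorphM, mulrDl, mulrDr, mulNr, mulrN, opprD, opprK, mulrA, addrA).
rewrite -[sc c * sc a * sc b]mulrA (alg_scalarC c (sc a * sc b)).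
rewrite (alg_scalarC c (sc a)) (alg_scalarC c (sc b)).
by rewrite [LHS](@GRing.add _).[ACl 1*2*6*5*8*4*7*3*9].
Qed.

Lemma hfun_g_braid i j f : j = i.+1 :> nat ->
  hfun_g i (hfun_g j (hfun_g i f)) = hfun_g j (hfun_g i (hfun_g j f)).
Proof.
move=> ij; apply/ffunP => chi; rewrite !ffunE swX_braid // !mulrA; congr (_ * _).
rewrite /hfun_coef !hecke_triple (hecke_T_braid heckeP ij).
have [e1 e2 e3 e4] := swX_adj ij chi.
have [f1 f2 f3 f4] := swX_adj ij (swX i chi); have [h1 h2 h3 h4] := swX_adj ij (swX j chi).
rewrite /asc_coef e1 e2 e3 e4 f3 f4 e1 h1 h2 e3 -(ord_hi_lo ij).
rewrite !swX_lo swX_hi -(ord_hi_lo ij).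
rewrite [RHS](@GRing.add _).[ACl 1*3*2*5*4*6].
move: (nat_of_ord (chi _)) (nat_of_ord (chi _)) (nat_of_ord (chi _)) => c b a.
have sc_congr x y h : x = y -> sc x * h = sc y * h by move=> ->.
do 5?[congr (_ + _)]; last (congr (alg_scalar H _)); try apply: sc_congr;
  case: (ltngtP a b) => ab; case: (ltngtP b c) => bc; case: (ltngtP a c) => ac;
  try (clear -ab bc ac; exfalso; lia);
  by rewrite ?(mulr0, mul0r, addr0, add0r, oppr0, subrr, addrK, sub0r).
Qed.

Lemma hfun_tC (i j : 'I_n) f : hfun_t i (hfun_t j f) = hfun_t j (hfun_t i f).
Proof. by apply/ffunP => chi; rewrite !ffunE !mulrA alg_scalarC. Qed.

Lemma hfun_g_t i (j : 'I_n) f : hfun_g i (hfun_t j f) = hfun_t (sw i j) (hfun_g i f).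
Proof.
apply/ffunP => chi; rewrite /hfun_g /hfun_t !ffunE !mulrA; congr (_ * _).
by rewrite alg_scalarC.
Qed.

Lemma hfun_tX (j : 'I_n) k f chi : iter k (hfun_t j) f chi = sc (char (chi j) ^+ k) * f chi.
Proof.
elim: k => [|k IH]; first by rewrite expr0 rmorph1 mul1r.
by rewrite iterS ffunE IH mulrA -rmorphM -exprS.
Qed.

Lemma hfun_t_d (j : 'I_n) f : iter d (hfun_t j) f = f.
Proof.
apply/ffunP => chi; rewrite hfun_tX -rmorphXn -exprM mulnC exprM.
by rewrite (prim_expr_order zetaP) expr1n !rmorph1 mul1r.
Qed.

Lemma hfun_idemE i f chi :
  (kap d%:R^-1 *: (\sum_(0 <= s < d)
     iter s (hfun_t (ord_lo i)) (iter (d - s) (hfun_t (ord_hi i)) f) : hfun)) chi =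
  if flat i chi then f chi else 0.
Proof.
rewrite hfunZ sum_ffunE.
under eq_bigr do rewrite !hfun_tX mulrA -rmorphM -!rmorphXn -rmorphM.
rewrite -mulr_suml -!rmorph_sum mulrA -!rmorphM sum_prim_root_exp //.
by rewrite /flat; case: eqP => _; rewrite ?rmorph1 ?rmorph0 ?mul1r ?mul0r.
Qed.

Lemma hfun_g_sq i f : hfun_g i (hfun_g i f) = u ^+ 2 *: f +
  v *: (kap d%:R^-1 *: (\sum_(0 <= s < d)
     iter s (hfun_t (ord_lo i)) (iter (d - s) (hfun_t (ord_hi i)) (hfun_g i f)) : hfun)).
Proof.
apply/ffunP => chi; rewrite ffunE [in LHS]ffunE [RHS]ffunE hfunZ [X in _ + X]hfunZ hfun_idemE.
rewrite swXK mulrA ffunE /hfun_coef /asc_coef /flat swX_lo swX_hi -val_eqE /=.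
(* Off equal letters exactly one of [chi] and [swX i chi] ascends at [i], so x and y are v and 0 in
   some order, and T_i (T_i - v) = u^2. *)
have TT x y : x + y = v -> x * y = 0 -> (T i - sc x) * (T i - sc y) = sc (u ^+ 2).
  move=> xy xy0; rewrite mulrBl !mulrBr -(alg_scalarC y) (hecke_T_sq heckeP).
  rewrite -rmorphM xy0 rmorph0 subr0 -addrA -opprD -mulrDl -rmorphD [y + x]addrC xy.
  by rewrite addrK.
case: ltngtP => lohi.
- by rewrite TT ?addr0 ?mulr0 ?addr0.
- by rewrite TT ?add0r ?mul0r ?mulr0 ?addr0.
rewrite (_ : swX i chi = chi); last by apply/flat_swX/eqP/val_inj.
by rewrite rmorph0 !subr0 (hecke_T_sq heckeP) mulrDl !mulrA.
Qed.

Definition hfun_delta chi (h : H) : hfun := [ffun chi' => if chi' == chi then h else 0].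

Lemma hfun_t_delta chi (j : 'I_n) h :
  hfun_t j (hfun_delta chi h) = char (chi j) *: hfun_delta chi h.
Proof.
apply/ffunP => chi'; rewrite hfunZ !ffunE; case: eqP => [->//|_].
by rewrite !mulr0.
Qed.

Lemma hfun_g_delta chi i h : flat i chi ->
  hfun_g i (hfun_delta chi h) = hfun_delta chi (T i * h).
Proof.
move=> fi; apply/ffunP => chi'; rewrite !ffunE.
have -> : (swX i chi' == chi) = (chi' == chi).
  by rewrite -[in LHS](flat_swX fi) (inj_eq (can_inj (@swXK n d i))).
case: eqP => [->|_]; last by rewrite mulr0.
by rewrite /hfun_coef /asc_coef (eqP fi) ltnn rmorph0 subr0.
Qed.

End HeckeFunctions.

(** * The corner at a sorted word *)

Section SortedCorner.
Variables (F : numFieldType) (A : comPzRingType) (kap : {rmorphism F -> A}).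
Variables (n d : nat) (zeta : F) (u v w : A) (Y : algebra A).
Variables (g : 'I_n.-1 -> Y) (t : 'I_n -> Y).
Hypothesis zetaP : d.-primitive_root zeta.
Hypothesis yokP : yok_relations kap d u v g t.
Hypothesis wu : w * u = 1.
Hypothesis Y_ind : forall Q : Y -> Prop,
  (forall i, Q (g i)) -> (forall j, Q (t j)) -> (forall a, Q (alg_scalar Y a)) ->
  (forall x y, Q x -> Q y -> Q (x + y)) -> (forall x y, Q x -> Q y -> Q (x * y)) ->
  forall y, Q y.
Variables (H : algebra A) (T : 'I_n.-1 -> H) (psi : {rmorphism H -> Y}).
Hypothesis psi_T : forall i, psi (T i) = psi_gen kap d zeta v g t i.
Hypothesis psi_sc : forall a, psi (alg_scalar H a) = alg_scalar Y a.
Local Notation sc := (alg_scalar Y).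
Local Notation X := {ffun 'I_n -> 'I_d}.
Local Notation wt := (@wt F A kap n d zeta Y t).
Local Notation idem := (idem kap zeta t).
Implicit Types (chi : X) (i j : 'I_n.-1) (y : Y).

Variable chi0 : X.

Definition flat_subalg : H -> Prop :=
  in_subalg (fun x => exists i, flat i chi0 /\ x = T i).

(** Equal letters are not a descent, so the correction vanishes. As g_i then fixes the weight
    [chi0], the image of H^mu preserves that weight space. *)
Lemma psi_flat (M : lmodType Y) i (z : M) :
  flat i chi0 -> wt chi0 z -> psi (T i) *: z = g i *: z.
Proof.
move=> /eqP fi wz; rewrite psi_T (wt_psi_gen v g zetaP i wz) /desc_coef /desc fi ltnn.
by rewrite rmorph0 scale0r addr0.
Qed.

Lemma wt_flat_subalg (M : lmodType Y) h (z : M) :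
  flat_subalg h -> wt chi0 z -> wt chi0 (psi h *: z).
Proof.
move=> hP; elim: hP z => {h} [_ [i [fi ->]]|a|x y _ IHx _ IHy|x y _ IHx _ IHy] z wz.
- by rewrite psi_flat //; have := wt_g yokP i wz; rewrite flat_swX.
- by rewrite psi_sc; apply: wtZ.
- by rewrite rmorphD scalerDl; apply: wtD; [apply: IHx|apply: IHy].
- by rewrite rmorphM -scalerA; apply/IHx/IHy.
Qed.

Lemma idem_mul chi chi' y : wt chi (y : Y^o) ->
  idem chi' * y = if chi' == chi then y else 0.
Proof. exact: (idem_wt zetaP). Qed.

Lemma idem_sq chi : idem chi * idem chi = idem chi.
Proof. by rewrite (idem_mul _ (wt_idem zetaP yokP chi)) eqxx. Qed.

Lemma idem_psi h : flat_subalg h ->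
  idem chi0 * (psi h * idem chi0) = psi h * idem chi0.
Proof.
move=> hP; have := wt_flat_subalg hP (wt_idem zetaP yokP chi0 : wt chi0 (idem chi0 : Y^o)).
by move=> /(idem_wt zetaP chi0); rewrite eqxx.
Qed.

Hypothesis chi0_sorted : sorted_word chi0.

(* [z] is the product of elements [u^-1 g_i] along some way of sorting [chi]
   into [chi0], times the idempotent of [chi0]. *)
Inductive reach : X -> Y -> Prop :=
  | reach0 : reach chi0 (idem chi0)
  | reachS chi i z : desc i chi -> reach (swX i chi) z -> reach chi (sc w * (g i * z)).

Lemma reach_wt chi z : reach chi z -> wt chi (z : Y^o).
Proof.
elim=> {chi z} [|chi i z _ _ wz]; first exact: (wt_idem zetaP yokP).
by have := wtZ w (wt_g yokP i wz); rewrite swXK.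
Qed.

Lemma reach_content chi z : reach chi z -> same_content chi chi0.
Proof. by elim=> // {}chi i {}z _ _ IH c; rewrite -IH count_swX. Qed.

Lemma not_desc_sorted chi : (forall i, ~~ desc i chi) -> same_content chi chi0 -> chi = chi0.
Proof. by move=> nd; apply: sorted_content_uniq => //; apply/forallP. Qed.

Lemma reach_exists chi : same_content chi chi0 -> exists z, reach chi z.
Proof.
elim/word_ind: chi => chi IH e.
case: (pselect (exists i, desc i chi)) => [[i di]|nd]; last first.
  exists (idem chi0); rewrite (not_desc_sorted _ e); first exact: reach0.
  by move=> i; apply/negP => di; apply: nd; exists i.
have [|z rz] := IH _ (desc_meas di); first by move=> c; rewrite count_swX.
by exists (sc w * (g i * z)); apply: reachS.
Qed.

Let scE a y : sc a * y = y * sc a. Proof. exact: alg_scalarC. Qed.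
Let g_sc i a y : g i * (sc a * y) = sc a * (g i * y).
Proof. by rewrite mulrA -scE -mulrA. Qed.

Let braidE i j y : braid_adj i j -> g i * (g j * (g i * y)) = g j * (g i * (g j * y)).
Proof.
by case=> ij; rewrite !mulrA ?(yok_g_braid yokP ij) // -(yok_g_braid yokP ij).
Qed.
Let farE i j y : far i j -> g i * (g j * y) = g j * (g i * y).
Proof. by move=> ij; rewrite !mulrA (yok_g_far yokP ij). Qed.

Lemma reach_inv chi z : reach chi z -> chi = chi0 /\ z = idem chi0 \/
  exists i z', [/\ desc i chi, reach (swX i chi) z' & z = sc w * (g i * z')].
Proof. by case=> [|{}chi i {}z di rz]; [left|right; exists i, z]. Qed.

(** Local confluence and induction on [word_meas], as in Newman's lemma. Two different first
    descents are far apart, and commute, or adjacent, and both extend to the two sides of a braid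
    relation; [reach_exists] supplies the common continuation. *)
Lemma reach_uniq chi z z' : reach chi z -> reach chi z' -> z = z'.
Proof.
elim/word_ind: chi z z' => chi IH z z' rz rz'.
have e2 i : same_content (swX i chi) chi0.
  by move=> c; rewrite count_swX (reach_content rz).
have e3 i j : same_content (swX j (swX i chi)) chi0 by move=> c; rewrite count_swX e2.
have nd0 i : desc i chi0 = false by apply/negbTE/(forallP chi0_sorted).
case: (reach_inv rz) (reach_inv rz') => [[E ->]|[i [z1 [di {}rz ->]]]].
  by case=> [[_ ->] //|[i [z1 [di]]]]; rewrite E nd0 in di.
case=> [[E _]|[k [z2 [dk {}rz' ->]]]]; first by rewrite E nd0 in di.
have IHi := IH _ (desc_meas di); have IHk := IH _ (desc_meas dk).
case: (far_or_adj i k) => [ik|ik|ik].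
- by rewrite -ik in rz' *; rewrite (IHi _ _ rz rz').
- have ki : far k i by rewrite farC.
  have [y ry] := reach_exists (e3 i k).
  have dk' : desc k (swX i chi) by rewrite desc_far.
  have di' : desc i (swX k chi) by rewrite desc_far.
  rewrite (IHi _ _ rz (reachS dk' ry)).
  rewrite -swXC // in ry; rewrite (IHk _ _ rz' (reachS di' ry)).
  by rewrite !g_sc farE.
have ki : braid_adj k i by case: ik; [right|left].
have [di1 dk2] := (adj_values chi ik).2 di dk.
have [dk1 di2] := (adj_values chi ki).2 dk di.
have e4 : same_content (swX i (swX k (swX i chi))) chi0.
  by move=> c; rewrite count_swX e3.
have [y ry] := reach_exists e4.
rewrite (IHi _ _ rz (reachS dk1 (reachS di2 ry))).
rewrite swX_braid_adj // in ry; rewrite (IHk _ _ rz' (reachS di1 (reachS dk2 ry))).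
by rewrite !g_sc braidE.
Qed.

(** By uniqueness, any descent may be chosen as the first sorting step. *)
Lemma reach_desc chi i z : reach chi z -> desc i chi ->
  exists2 z', reach (swX i chi) z' & z = sc w * (g i * z').
Proof.
move=> rz di; have [|z' rz'] := @reach_exists (swX i chi).
  by move=> c; rewrite count_swX; apply: (reach_content rz).
by exists z' => //; apply: reach_uniq rz _; apply: reachS.
Qed.

(** Sorting carries a pair of equal letters to a pair of equal letters of [chi0], and g_i travels
    along with it through z. *)
Lemma reach_flat chi i z : reach chi z -> flat i chi ->
  exists2 j, flat j chi0 & g i * z = z * (g j * idem chi0).
Proof.
elim/word_ind: chi i z => chi IH i z rz fi.
case: (pselect (exists k, desc k chi)) => [[k dk]|nd]; last first.
  have E : chi = chi0.
    apply: not_desc_sorted (reach_content rz) => k.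
    by apply/negP => dk; apply: nd; exists k.
  rewrite E in rz fi; exists i => //; rewrite (reach_uniq rz reach0).
  have := wt_g yokP i (wt_idem zetaP yokP chi0); rewrite flat_swX //.
  by move=> /(idem_wt zetaP chi0); rewrite eqxx.
have [z1 rz1 ->] := reach_desc rz dk.
case: (far_or_adj i k) => [ik|ik|ik].
- by move: dk fi; rewrite ik /flat /desc => /[swap] /eqP->; rewrite ltnn.
- have fi' : flat i (swX k chi) by rewrite flat_far // farC.
  have [j fj E] := IH _ (desc_meas dk) _ _ rz1 fi'.
  by exists j => //; rewrite g_sc farE // E !mulrA.
(* The third letter must pass both equal ones, so z begins with g_k g_i, and g_i g_k g_i = g_k g_i
   g_k hands the equal pair over from i to k. *)
have [di1 fk2] := (adj_values chi ik).1 fi dk.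
have [z2 rz2 ->] := reach_desc rz1 di1.
have lt2 := ltn_trans (desc_meas di1) (desc_meas dk).
have [j fj E] := IH _ lt2 _ _ rz2 fk2.
by exists j => //; rewrite !g_sc braidE // E !mulrA.
Qed.

Inductive corner_span : Y -> Prop :=
  | corner_span0 : corner_span 0
  | corner_spanD x y : corner_span x -> corner_span y -> corner_span (x + y)
  | corner_span_reach chi z h : reach chi z -> flat_subalg h ->
      corner_span (z * (psi h * idem chi0)).

(** The span is a left ideal, as it is stable under all generators. Since it contains the idempotent
    of [chi0], it contains all of Y E. *)
Lemma corner_spanM y x : corner_span x -> corner_span (y * x).
Proof.
move: y x; apply: Y_ind => [i|j|a|y y' IHy IHy'|y y' IHy IHy'] x xP.
- elim: xP => {x} [|x x' _ IHx _ IHx'|chi z h rz hP].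
  + by rewrite mulr0; apply: corner_span0.
  + by rewrite mulrDr; apply: corner_spanD.
  have scw a z' : reach (swX i chi) z' ->
      corner_span (sc a * z' * (psi h * idem chi0)).
    move=> rz'; have -> : sc a * z' * (psi h * idem chi0) =
        z' * (psi (alg_scalar H a * h) * idem chi0).
      by rewrite rmorphM psi_sc scE !mulrA.
    by apply: corner_span_reach rz' _; apply: in_subalg_mul => //; apply: in_subalg_scalar.
  rewrite mulrA; case: (ltngtP (chi (ord_lo i)) (chi (ord_hi i))) => lohi.
  (* Ascent: g_i prolongs the sorting path by one step, up to the factor u. *)
  + have di : desc i (swX i chi) by rewrite /desc swX_lo swX_hi.
    have rz' : reach (swX i chi) (sc w * (g i * z)) by apply: reachS; rewrite ?swXK.
    have -> : g i * z = sc u * (sc w * (g i * z)).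
      by rewrite [RHS]mulrA -rmorphM mulrC wu rmorph1 mul1r.
    exact: scw.
  (* Descent: z can be made to begin with w g_i, and g_i w g_i acts as w u^2 = u. *)
  + have [z' rz' ->] := reach_desc rz lohi.
    have -> : g i * (sc w * (g i * z')) = sc u * z'; last exact: scw.
    have := wt_gg zetaP yokP i (reach_wt rz'); rewrite swX_lo swX_hi -val_eqE /= ltn_eqF // addr0.
    move=> E; rewrite g_sc (E : g i * (g i * z') = sc (u ^+ 2) * z').
    by rewrite mulrA -rmorphM expr2 mulrA wu mul1r.
  (* Equal letters: g_i crosses z and is absorbed into the Hecke factor as some T_j. *)
  have fi : flat i chi by apply/eqP/val_inj.
  have [j fj ->] := reach_flat rz fi.
  have -> : z * (g j * idem chi0) * (psi h * idem chi0) =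
      z * (psi (T j * h) * idem chi0).
    rewrite -!mulrA idem_psi // rmorphM -!mulrA; congr (z * _).
    have := wt_flat_subalg hP (wt_idem zetaP yokP chi0 : wt chi0 (idem chi0 : Y^o)).
    by move=> /(psi_flat fj).
  apply: corner_span_reach rz _; apply: in_subalg_mul => //.
  by apply: in_subalg_gen; exists j.
- elim: xP => {x} [|x x' _ IHx _ IHx'|chi z h rz hP].
  + by rewrite mulr0; apply: corner_span0.
  + by rewrite mulrDr; apply: corner_spanD.
  have -> : t j * (z * (psi h * idem chi0)) =
      z * (psi (alg_scalar H (kap (zeta ^+ chi j)) * h) * idem chi0).
    rewrite mulrA [t j * z](reach_wt rz j) rmorphM psi_sc !mulrA -scE.
    by [].
  apply: corner_span_reach rz _; apply: in_subalg_mul => //; exact: in_subalg_scalar.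
- elim: xP => {x} [|x x' _ IHx _ IHx'|chi z h rz hP].
  + by rewrite mulr0; apply: corner_span0.
  + by rewrite mulrDr; apply: corner_spanD.
  have -> : sc a * (z * (psi h * idem chi0)) = z * (psi (alg_scalar H a * h) * idem chi0).
    by rewrite rmorphM psi_sc !mulrA -scE.
  apply: corner_span_reach rz _; apply: in_subalg_mul => //; exact: in_subalg_scalar.
- by rewrite mulrDl; apply: corner_spanD; [apply: IHy|apply: IHy'].
- by rewrite -mulrA; apply/IHy/IHy'.
Qed.

Lemma idem_corner_span : corner_span (idem chi0).
Proof.
have := corner_span_reach reach0 (in_subalg_scalar _ 1).
rewrite psi_sc rmorph1 mul1r.
by rewrite idem_sq.
Qed.

(** E kills every spanning element z psi(h) E except those with z of weight [chi0]; for these z = E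
    by [reach_uniq], the path being empty. *)
Lemma corner_flat_subalg y :
  exists2 h, flat_subalg h & idem chi0 * y * idem chi0 = psi h * idem chi0.
Proof.
rewrite -mulrA; elim: (corner_spanM y idem_corner_span) => [|x x' _ [h hP E] _ [h' hP' E']|].
- exists 0; last by rewrite rmorph0 mulr0 mul0r.
  by rewrite -(rmorph0 (alg_scalar H)); apply: in_subalg_scalar.
- exists (h + h'); first exact: in_subalg_add.
  by rewrite mulrDr E E' rmorphD mulrDl.
move=> chi z h rz hP; have := idem_mul chi0 (reach_wt rz); have [E|ne] := eqVneq chi0 chi => e.
  exists h => //; rewrite mulrA e -E in rz *.
  by rewrite (reach_uniq rz reach0) idem_psi.
exists 0; last by rewrite mulrA e !mul0r rmorph0 mul0r.
by rewrite -(rmorph0 (alg_scalar H)); apply: in_subalg_scalar.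
Qed.

(** Sorting preserves content, so only weights with the content of [chi0] occur in Y E. *)
Lemma corner_orthogonal chi y : ~ same_content chi chi0 -> idem chi * y * idem chi0 = 0.
Proof.
move=> ne; rewrite -mulrA; elim: (corner_spanM y idem_corner_span) => [|x x' _ E _ E'|].
- by rewrite mulr0.
- by rewrite mulrDr E E' addr0.
move=> chi' z h rz hP; rewrite mulrA; have := idem_mul chi (reach_wt rz).
have [E|_ ->] := eqVneq chi chi'.
  by case: ne; rewrite E; apply: reach_content rz.
by rewrite mul0r.
Qed.

Lemma idem_full chi : same_content chi chi0 ->
  exists p : Y * Y, idem chi = p.1 * idem chi0 * p.2.
Proof.
(* The claim is generalised to any z in Y of weight chi, so that induction applies to g_k z. *)
have := wt_idem zetaP yokP chi; move: (idem chi) => z.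
elim/word_ind: chi z => chi IH z wz e.
case: (pselect (exists k, desc k chi)) => [[k dk]|nd]; last first.
  have E : chi = chi0.
    apply: not_desc_sorted e => k.
    by apply/negP => dk; apply: nd; exists k.
  exists (1, z); rewrite mul1r /=; have := idem_wt zetaP chi0 wz.
  by rewrite E eqxx.
have e' : same_content (swX k chi) chi0 by move=> c; rewrite count_swX.
have [[a b] /= E] := IH _ (desc_meas dk) _ (wt_g yokP k wz) e'.
(* On distinct letters g_k^2 acts as u^2, hence z = w^2 g_k (g_k z). *)
exists (sc (w ^+ 2) * (g k * a), b) => /=.
have := wt_gg zetaP yokP k wz; rewrite -val_eqE gtn_eqF // addr0 => E2.
rewrite -!mulrA [a * _]mulrA -(E : g k * z = _) (E2 : g k * (g k * z) = sc (u ^+ 2) * z).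
by rewrite mulrA -rmorphM -exprMn wu expr1n rmorph1 mul1r.
Qed.

End SortedCorner.

(** * The corners of the Yokonuma-Hecke algebra *)

Section YokonumaCorners.
Variables (K : realType) (n d : nat) (zeta : K[i]).
Hypothesis zetaP : d.-primitive_root zeta.
Local Notation A := (Cuv K).
Local Notation u := (Cuv_u K).
Local Notation v := (Cuv_v K).
Local Notation Y := (yokonuma K n d).
Local Notation H := (hecke K n).
Local Notation kap := (@Cuv_const K).
Local Notation X := {ffun 'I_n -> 'I_d}.
Local Notation yrel := (@yok_rel K n d).
Local Notation hrel := (@hecke_rel K n).

Definition yok_g (i : 'I_n.-1) : Y := pres_gen yrel (GenG i).
Definition yok_t (j : 'I_n) : Y := pres_gen yrel (GenT j).
Definition hecke_T (i : 'I_n.-1) : H := pres_gen hrel i.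

Let yrel_eval s t : yrel s t -> eval (pres_gen yrel) s = eval (pres_gen yrel) t.
Proof. exact: pres_gen_rel. Qed.

Lemma yokonuma_relations : yok_relations kap d u v yok_g yok_t.
Proof.
split=> [i j ij|i j ij|i j|i j|j|i].
- exact: (yrel_eval (@yok_comm K n d i j ij)).
- exact: (yrel_eval (@yok_braid K n d i j ij)).
- exact: (yrel_eval (@yok_tcomm K n d i j)).
- exact: (yrel_eval (@yok_gt K n d i j)).
- have := yrel_eval (@yok_tpow K n d j); rewrite eval_Exp /= => ->.
  exact: (rmorph1 (alg_scalar Y)).
have := yrel_eval (@yok_quad K n d i); rewrite eval_Exp expr2 => e.
apply: (etrans e) => /=; rewrite eval_sum /yok_idem.
by under eq_bigr do rewrite /= !eval_Exp.
Qed.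

Lemma yokonuma_ind (Q : Y -> Prop) :
  (forall i, Q (yok_g i)) -> (forall j, Q (yok_t j)) -> (forall a, Q (alg_scalar Y a)) ->
  (forall x y, Q x -> Q y -> Q (x + y)) -> (forall x y, Q x -> Q y -> Q (x * y)) ->
  forall y, Q y.
Proof.
move=> Qg Qt Qs Qa Qm; apply: pres_ind => // -[i|j]; [exact: Qg|exact: Qt].
Qed.

Let hrel_eval s t : hrel s t -> eval (pres_gen hrel) s = eval (pres_gen hrel) t.
Proof. exact: pres_gen_rel. Qed.

Lemma hecke_relationsP : hecke_relations u v hecke_T.
Proof.
split=> [i j ij|i j ij|i].
- exact: (hrel_eval (@hecke_comm K n i j ij)).
- exact: (hrel_eval (@hecke_braid K n i j ij)).
have := hrel_eval (@hecke_quad K n i); rewrite eval_Exp expr2 => e.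
exact: (etrans e).
Qed.

Local Notation psi_fun := (psi_gen kap d zeta v yok_g yok_t).

Lemma psi_rel s t : hrel s t -> eval psi_fun s = eval psi_fun t.
Proof.
case=> [i j ij|i j ij|i].
- exact: (psi_gen_far zetaP yokonuma_relations ij).
- exact: (psi_gen_braid zetaP yokonuma_relations ij).
rewrite eval_Exp expr2 [LHS](psi_gen_sq zetaP yokonuma_relations i).
by [].
Qed.

Definition psi : {rmorphism H -> Y} := pres_lift psi_rel.

Lemma psi_T i : psi (hecke_T i) = psi_fun i. Proof. exact: pres_lift_gen. Qed.
Lemma psi_scalar a : psi (alg_scalar H a) = alg_scalar Y a.
Proof. exact: pres_lift_scalar. Qed.

Local Notation V := (hfun n d H).

Definition hfun_act (x : yok_gen n) : {linear V -> V} :=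
  match x with
  | GenG i => hfun_g v hecke_T i
  | GenT j => hfun_t kap zeta j
  end.

Lemma hfun_act_rel s t : yrel s t -> act hfun_act s =1 act hfun_act t.
Proof.
case=> [i j ij|i j ij|i j|i j|j|i] f.
- exact: (hfun_g_far hecke_relationsP f ij).
- exact: (hfun_g_braid hecke_relationsP f ij).
- exact: hfun_tC.
- exact: hfun_g_t.
- by rewrite act_Exp /= scale1r; apply: hfun_t_d.
rewrite act_Exp [LHS](hfun_g_sq kap zetaP hecke_relationsP) /=.
rewrite act_sum; congr (_ + v *: (_ *: _)); apply: eq_bigr => k _.
by rewrite /= !act_Exp.
Qed.

Definition hecke_module : lmodType Y := pres_module hfun_act_rel.
Local Notation M := hecke_module.

Lemma hecke_module_scalar a (z : M) : alg_scalar Y a *: z = (a *: (z : V)).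
Proof. exact: pres_module_scalar. Qed.

Local Notation delta chi h := (hfun_delta chi h : M).

Lemma wt_delta chi h : wt kap zeta yok_t chi (delta chi h).
Proof.
move=> j; rewrite hecke_module_scalar [LHS]pres_module_gen.
exact: hfun_t_delta.
Qed.

Lemma psi_delta chi h c : flat_subalg hecke_T chi h ->
  psi h *: delta chi c = delta chi (h * c).
Proof.
move=> hP; elim: hP c => {h} [_ [i [fi ->]]|a|x y _ IHx _ IHy|x y _ IHx _ IHy] c.
- rewrite (psi_flat zetaP psi_T fi (wt_delta _ _)) [LHS]pres_module_gen.
  exact: hfun_g_delta.
- rewrite psi_scalar hecke_module_scalar.
  by apply/ffunP => chi'; rewrite hfunZ !ffunE; case: eqP; rewrite ?mulr0.
- rewrite rmorphD scalerDl IHx IHy.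
  by apply/ffunP => chi'; rewrite !ffunE mulrDl; case: eqP; rewrite ?addr0.
- by rewrite rmorphM -scalerA IHy IHx mulrA.
Qed.

Lemma in_subalg_ext (B : algebra A) (S S' : B -> Prop) x :
  (forall y, S y <-> S' y) -> in_subalg S x -> in_subalg S' x.
Proof.
move=> SS'; elim=> [y /SS'|r|y y' _ IHy _ IHy'|y y' _ IHy _ IHy'].
- exact: in_subalg_gen.
- exact: in_subalg_scalar.
- exact: in_subalg_add.
- exact: in_subalg_mul.
Qed.

(** * The isomorphism of H^mu with the corner at its sorted word *)

Section Composition.
Variable mu : Comp d n.
Local Notation B := (hecke_parabolic K mu).
Local Notation chi := (comp_word mu).
Local Notation E := (idem kap zeta yok_t chi).

Lemma parabolic_flat (h : H) : in_subalg (fun x => exists i : 'I_n.-1,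
    (forall k, (0 < k < d)%N -> i.+1 <> comp_psum mu k) /\ x = hecke_T i) h <->
  flat_subalg hecke_T chi h.
Proof.
by split; apply: in_subalg_ext => y; split=> -[i [fi ->]]; exists i; split=> //;
  apply/comp_word_flat.
Qed.

Lemma val_parabolic_flat (h : B) : flat_subalg hecke_T chi (val h).
Proof. by apply/parabolic_flat/asboolP; apply: (valP h). Qed.

Definition corner_phi (h : B) : Y := psi (val h) * E.
Lemma corner_phi_zmod : zmod_morphism corner_phi.
Proof. by move=> x y; rewrite /corner_phi !rmorphB mulrBl. Qed.
HB.instance Definition _ := GRing.isZmodMorphism.Build B Y corner_phi corner_phi_zmod.

Lemma corner_phi1 : corner_phi 1 = E.
Proof. by rewrite /corner_phi !rmorph1 mul1r. Qed.

Lemma corner_phiM : {morph corner_phi : x y / x * y}.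
Proof.
move=> x y; rewrite /corner_phi !rmorphM -!mulrA; congr (_ * _).
by rewrite (idem_psi zetaP yokonuma_relations psi_T psi_scalar (val_parabolic_flat y)).
Qed.

Lemma corner_phiZ a x : corner_phi (alg_scalar B a * x) = alg_scalar Y a * corner_phi x.
Proof. by rewrite /corner_phi !rmorphM mulrA; congr (_ * _ * _); apply: psi_scalar. Qed.

(* In the module of Hecke-valued functions, [psi h] maps delta_chi to [h * delta_chi],
   so that [h] can be read off from [psi h * E]. *)
Definition corner_lam_val (y : Y) : H := ((E * y * E) *: delta chi 1 : V) chi.

Lemma corner_lam_valE y h : flat_subalg hecke_T chi h ->
  E * y * E = psi h * E -> corner_lam_val y = h.
Proof.
move=> hP e; rewrite /corner_lam_val e -scalerA.
rewrite (idem_wt zetaP chi (wt_delta chi 1)) eqxx (psi_delta _ hP) ffunE eqxx.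
by rewrite mulr1.
Qed.

Lemma corner_lam_ex y : exists2 h, flat_subalg hecke_T chi h & E * y * E = psi h * E.
Proof.
have [w wu] := Cuv_u_inv K.
exact: (corner_flat_subalg zetaP yokonuma_relations wu yokonuma_ind psi_T psi_scalar
  (comp_word_sorted mu)).
Qed.

Lemma corner_lam_subproof y : in_subalgb (B := H) (fun x => exists i : 'I_n.-1,
  (forall k, (0 < k < d)%N -> i.+1 <> comp_psum mu k) /\ x = hecke_T i) (corner_lam_val y).
Proof.
have [h hP e] := corner_lam_ex y; rewrite (corner_lam_valE hP e).
by apply/asboolP/parabolic_flat.
Qed.

(** Given by a formula rather than by choosing the h of [corner_lam_ex]: additivity and A-linearity
    on all of Y are then read off. *)
Definition corner_lam (y : Y) : B := Sub _ (corner_lam_subproof y).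

Lemma corner_lam_zmod : zmod_morphism corner_lam.
Proof.
move=> x y; apply: val_inj.
by rewrite [RHS]rmorphB /= /corner_lam_val mulrBr mulrBl scalerBl !ffunE.
Qed.
HB.instance Definition _ := GRing.isZmodMorphism.Build Y B corner_lam corner_lam_zmod.

Lemma corner_lamZ a y : corner_lam (alg_scalar Y a * y) = alg_scalar B a * corner_lam y.
Proof.
apply: val_inj; rewrite [RHS]rmorphM /= /corner_lam_val.
rewrite mulrA -alg_scalarC -!mulrA -scalerA mulrA.
by rewrite hecke_module_scalar hfunZ.
Qed.

Lemma corner_phiK : cancel corner_phi corner_lam.
Proof.
move=> h; apply: val_inj; apply: corner_lam_valE; first exact: val_parabolic_flat.
rewrite /corner_phi (idem_psi zetaP yokonuma_relations psi_T psi_scalar (val_parabolic_flat h)).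
by rewrite -mulrA (idem_sq zetaP yokonuma_relations).
Qed.

Lemma corner_lamK y : corner_phi (corner_lam y) = corner_phi 1 * y * corner_phi 1.
Proof.
rewrite corner_phi1; have [h hP e] := corner_lam_ex y.
by rewrite /corner_phi /= (corner_lam_valE hP e).
Qed.

End Composition.

Lemma corner_phi_orth mu nu y : mu != nu -> @corner_phi mu 1 * y * @corner_phi nu 1 = 0.
Proof.
move=> ne; rewrite !corner_phi1; have [w wu] := Cuv_u_inv K.
apply: (corner_orthogonal zetaP yokonuma_relations wu yokonuma_ind psi_T psi_scalar
  (comp_word_sorted nu)).
by move=> /comp_word_same e; rewrite e eqxx in ne.
Qed.

Lemma corner_phi_full : exists (p : X -> Y * Y),
  \sum_chi (p chi).1 * @corner_phi (content chi) 1 * (p chi).2 = 1.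
Proof.
have [w wu] := Cuv_u_inv K.
have full chi := cid (idem_full zetaP yokonuma_relations wu
  (comp_word_sorted (content chi)) (comp_word_content chi)).
exists (fun chi => projT1 (full chi)); rewrite -(sum_idem kap yok_t zetaP).
apply: eq_bigr => chi _; rewrite corner_phi1.
by case: (full chi) => p /= ->.
Qed.

End YokonumaCorners.

Theorem proposition4p1 (K : realType) (d n : nat)
    (d_ge1 : (1 <= d)%N) (n_ge1 : (1 <= n)%N)
    (R : comPzRingType) (theta : {rmorphism Cuv K -> R}) :
  morita_equivalent
    (base_change theta (yokonuma K n d))
    (direct_sum (fun mu : Comp d n => base_change theta (hecke_parabolic K mu))).
Proof.
have [zeta zetaP] := closed_prim_root_exists K[i] d_ge1.
apply: (@orthogonal_corners_morita _ R theta _ _ _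
  (fun mu => @corner_phi K n d zeta zetaP mu) (fun mu => @corner_lam K n d zeta zetaP mu)).
- exact: corner_phiM.
- exact: corner_phiZ.
- exact: corner_lamZ.
- exact: corner_phiK.
- exact: corner_lamK.
- exact: corner_phi_orth.
by have [p p1] := corner_phi_full n zetaP; exists _, (@content n d), p.
Qed.
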